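(* There exist a unique $\tau\in\mathbb{C}$ with $\operatorname{Im}\tau<0$ and a unique function $W=W(z)$ such that $W:\mathbb{R}\to\mathbb{C}$ is a smooth solution of $$(\tau-z^2)^2W'(z)+i\frac{d^3}{dz^3}\Big[(\tau-z^2)W(z)\Big]=0,\qquad z\in\mathbb{R},$$ with $\lim_{z\to-\infty}W(z)=0$ and $\lim_{z\to+\infty}W(z)=1$. They are given by $$\tau=e^{\frac{5\pi}{4}i}=-\frac{1+i}{\sqrt2},\qquad W(z)=\frac12\left(1+\operatorname{erf}\Big(\frac{\eta(z)}{\sqrt2}\Big)+\sqrt{\frac2\pi}\,\frac{\eta(z)}{1+\eta(z)^2}\,e^{-\frac{\eta(z)^2}{2}}\right),\qquad \eta(z)=e^{-\frac{i\pi}{8}}z.$$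
   Context: $\operatorname{erf}(\zeta)=\frac{2}{\sqrt\pi}\int_0^\zeta e^{-\omega^2}\,d\omega$ is the Gauss error function for $\zeta\in\mathbb{C}$ (an entire function; the integral is along any path from $0$ to $\zeta$). *)

(* Defs.v *)
From Stdlib Require Import Reals.
From Coquelicot Require Import Coquelicot.
Open Scope R_scope.

Definition Cexp (z : C) : C :=
  (exp (Re z) * cos (Im z), exp (Re z) * sin (Im z)).

(** The integrand is entire, so the integral from [0] to [zeta] does not
    depend on the path; the straight segment [t |-> t * zeta] is used. *)
Definition Cerf (zeta : C) : C :=
  (RtoC (2 / sqrt PI) *
   RInt (V := C_R_CompleteNormedModule)
     (fun t : R => zeta * Cexp (- (t * zeta) ^ 2)) 0 1)%C.

(** Coquelicot's total operator [Derive] is only available for [R -> R];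
    the two lemmas below relate [CDerive] to [is_derive] in the real normed
    module [C]. *)
Definition CDerive (f : R -> C) (x : R) : C :=
  (Derive (fun t => Re (f t)) x, Derive (fun t => Im (f t)) x).

Fixpoint CDerive_n (f : R -> C) (n : nat) : R -> C :=
  match n with
  | O => f
  | S m => CDerive (CDerive_n f m)
  end.

Lemma is_CDerive_unique (f : R -> C) (x : R) (l : C) :
  is_derive (V := C_R_NormedModule) f x l -> CDerive f x = l.
Proof.
  intros H. destruct l as [l1 l2]. unfold CDerive. f_equal.
  - apply is_derive_unique.
    exact (filterdiff_comp' (W := R_NormedModule) f (fun p : C_R_NormedModule => fst p) x _ _ H
             (filterdiff_linear _ is_linear_fst)).
  - apply is_derive_unique.
    exact (filterdiff_comp' (W := R_NormedModule) f (fun p : C_R_NormedModule => snd p) x _ _ H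
             (filterdiff_linear _ is_linear_snd)).
Qed.

Lemma CDerive_correct (f : R -> C) (x : R) :
  ex_derive (V := C_R_NormedModule) f x ->
  is_derive (V := C_R_NormedModule) f x (CDerive f x).
Proof.
  intros [l Hl]. now rewrite (is_CDerive_unique f x l Hl).
Qed.

Definition Csmooth (f : R -> C) : Prop :=
  forall (n : nat) (x : R),
    ex_derive (V := C_R_NormedModule) (CDerive_n f n) x.

Definition shear_layer_solution (tau : C) (W : R -> C) : Prop :=
  Csmooth W /\
  (forall z : R,
     ((tau - RtoC z ^ 2) ^ 2 * CDerive W z
      + Ci * CDerive_n (fun y : R => (tau - RtoC y ^ 2) * W y) 3 z)%C
     = RtoC 0) /\
  filterlim W (Rbar_locally m_infty) (locally (T := C_UniformSpace) (RtoC 0)) /\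
  filterlim W (Rbar_locally p_infty) (locally (T := C_UniformSpace) (RtoC 1)).

Definition eta (z : R) : C := (Cexp (- (Ci * (PI / 8)%R)) * z)%C.

(* Main.v *)
(** Write [a = tau - z^2] and [omega = e^(i pi/4)]. The equation reads
    [a^2 W' + i (a W''' - 6 z W'' - 6 W') = 0]. Fourier transformation turns
    [(a W)''] into a solution [g] of the rotated radial oscillator
    [- g'' + 2 g / k^2 + i k^2 g = tau g], whose [1/k] singularity at [k = 0] comes
    from the different limits of [W]. The annihilation operator
    [d/dk + 1/k + omega k] removes this singularity and intertwines with the
    oscillator without [2/k^2]. In the variable [z] it produces the function
    [F = omega (a W)''' + z (a W)'' - (a W)'], which satisfies
    [i F'' + (a - 2 omega) F = 0]. If [Im tau < 0], then
    [(|F|^2)'' >= 2 (sqrt 2 - Im tau) |F|^2], so a polynomially bounded [F] vanishes;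
    the bound follows from that of [W] by a Landau inequality. From [F = F' = 0] one
    obtains [(tau + omega) W' = 0] and a first order linear equation for [W'], hence
    both uniqueness statements.

    The limits of the explicit solution come from the complex Gaussian integral
    [P(u)] of [kappa exp(-(kappa s)^2)] over [0, u]: the sum of [P(u)^2] and of the
    integral of [exp(-kappa^2 u^2 (1 + t^2)) / (1 + t^2)] over [0 <= t <= 1] is
    constantly [pi/4], and [Re P > 0] on the positive axis selects the root
    [sqrt pi / 2]. *)
Require Import Defs.
From Stdlib Require Import Reals Lra Lia Psatz.
From Coquelicot Require Import Coquelicot.
Open Scope R_scope.

(** * Calculus of complex-valued functions of a real variable *)

(** The derivative is carried as an explicit function, so that the rules below compose as terms;
    [derives_ext] and [ring] then bring the composed derivative to the wanted form. *)
Definition derives (f df : R -> C) : Prop :=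
  forall x, is_derive (V := C_R_NormedModule) f x (df x).

(** Reduces complex derivatives to real ones. The converse reassembles [f] as [Re f] times [(1, 0)]
    plus [Im f] times [(0, 1)]. *)
Lemma is_derive_C_pair (f : R -> C) (x : R) (l : C) :
  is_derive (V := C_R_NormedModule) f x l <->
  is_derive (fun t => Re (f t)) x (Re l) /\ is_derive (fun t => Im (f t)) x (Im l).
Proof.
  split.
  - intros H; split.
    + exact (filterdiff_comp' (W := R_NormedModule) f
               (fun p : C_R_NormedModule => fst p) x _ _ H
               (filterdiff_linear _ is_linear_fst)).
    + exact (filterdiff_comp' (W := R_NormedModule) f
               (fun p : C_R_NormedModule => snd p) x _ _ H
               (filterdiff_linear _ is_linear_snd)).
  - intros [H1 H2].
    pose proof (is_derive_plus (V := C_R_NormedModule) _ _ _ _ _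
      (is_derive_scal_l (V := C_R_NormedModule) _ _ _ ((1, 0) : C) H1)
      (is_derive_scal_l (V := C_R_NormedModule) _ _ _ ((0, 1) : C) H2)) as H.
    refine (eq_rect _ (fun l => is_derive (V := C_R_NormedModule) f x l)
              (is_derive_ext _ _ _ _ _ H) _ _).
    + intros t. destruct (f t) as [u v]. simpl.
      apply injective_projections; cbn; ring.
    + destruct l as [u v].
      apply injective_projections; cbn; ring.
Qed.

Lemma derives_Re (f df : R -> C) :
  derives f df -> forall x, is_derive (fun t => Re (f t)) x (Re (df x)).
Proof. intros H x. exact (proj1 (proj1 (is_derive_C_pair f x _) (H x))). Qed.

Lemma derives_Im (f df : R -> C) :
  derives f df -> forall x, is_derive (fun t => Im (f t)) x (Im (df x)).
Proof. intros H x. exact (proj2 (proj1 (is_derive_C_pair f x _) (H x))). Qed.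

Lemma derives_ext (f df g dg : R -> C) :
  derives f df -> (forall x, f x = g x) -> (forall x, df x = dg x) -> derives g dg.
Proof.
  intros H E1 E2 x. rewrite <- E2.
  exact (is_derive_ext _ _ _ _ E1 (H x)).
Qed.

Lemma derives_const (c : C) : derives (fun _ => c) (fun _ => 0%C).
Proof.
  intros x. apply is_derive_C_pair. cbn.
  split; exact (is_derive_const _ x).
Qed.

Lemma derives_id : derives RtoC (fun _ => 1%C).
Proof.
  intros x. apply is_derive_C_pair. cbn.
  split; [exact (is_derive_id x) | exact (is_derive_const _ x)].
Qed.

Lemma derives_plus (f df g dg : R -> C) :
  derives f df -> derives g dg ->
  derives (fun x => f x + g x)%C (fun x => df x + dg x)%C.
Proof.
  intros Hf Hg x.
  exact (is_derive_plus (V := C_R_NormedModule) f g x _ _ (Hf x) (Hg x)).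
Qed.

Lemma derives_opp (f df : R -> C) :
  derives f df -> derives (fun x => - f x)%C (fun x => - df x)%C.
Proof.
  intros Hf x. exact (is_derive_opp (V := C_R_NormedModule) f x _ (Hf x)).
Qed.

Lemma derives_minus (f df g dg : R -> C) :
  derives f df -> derives g dg ->
  derives (fun x => f x - g x)%C (fun x => df x - dg x)%C.
Proof. intros Hf Hg. exact (derives_plus _ _ _ _ Hf (derives_opp _ _ Hg)). Qed.

Lemma derives_mult (f df g dg : R -> C) :
  derives f df -> derives g dg ->
  derives (fun x => f x * g x)%C (fun x => df x * g x + f x * dg x)%C.
Proof.
  intros Hf Hg x. apply is_derive_C_pair.
  pose proof (derives_Re _ _ Hf x) as F1. pose proof (derives_Im _ _ Hf x) as F2.
  pose proof (derives_Re _ _ Hg x) as G1. pose proof (derives_Im _ _ Hg x) as G2.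
  split.
  - eapply is_derive_ext;
      [| refine (eq_rect _ (fun l => is_derive _ x l)
           (is_derive_minus (V := R_NormedModule) _ _ _ _ _
             (is_derive_mult _ _ _ _ _ F1 G1 Rmult_comm)
             (is_derive_mult _ _ _ _ _ F2 G2 Rmult_comm)) _ _)].
    + intros t; cbn; reflexivity.
    + cbn; unfold Re, Im; ring.
  - eapply is_derive_ext;
      [| refine (eq_rect _ (fun l => is_derive _ x l)
           (is_derive_plus (V := R_NormedModule) _ _ _ _ _
             (is_derive_mult _ _ _ _ _ F1 G2 Rmult_comm)
             (is_derive_mult _ _ _ _ _ F2 G1 Rmult_comm)) _ _)].
    + intros t; cbn; reflexivity.
    + cbn; unfold Re, Im; ring.
Qed.

Lemma derives_cmul (c : C) (f df : R -> C) :
  derives f df -> derives (fun x => c * f x)%C (fun x => c * df x)%C.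
Proof.
  intros Hf.
  refine (derives_ext _ _ _ _ (derives_mult _ _ _ _ (derives_const c) Hf) _ _);
    intros x; ring.
Qed.

Lemma derives_exp (f df : R -> C) :
  derives f df -> derives (fun x => Cexp (f x)) (fun x => df x * Cexp (f x))%C.
Proof.
  intros Hf x. apply is_derive_C_pair.
  pose proof (derives_Re _ _ Hf x) as F1. pose proof (derives_Im _ _ Hf x) as F2.
  unfold Cexp, Cmult, Re, Im in *. cbn [fst snd].
  set (u := fun t => fst (f t)) in *. set (v := fun t => snd (f t)) in *.
  change (is_derive u x (fst (df x))) in F1. change (is_derive v x (snd (df x))) in F2.
  change (fst (f x)) with (u x). change (snd (f x)) with (v x).
  split.
  - apply (is_derive_ext (fun t => exp (u t) * cos (v t))); [reflexivity|].
    auto_derive.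
    + repeat split; eexists; eassumption.
    +
      replace (Derive (fun t => u t) x) with (fst (df x))
        by (symmetry; exact (is_derive_unique _ _ _ F1));
      replace (Derive (fun t => v t) x) with (snd (df x))
        by (symmetry; exact (is_derive_unique _ _ _ F2)). ring.
  - apply (is_derive_ext (fun t => exp (u t) * sin (v t))); [reflexivity|].
    auto_derive.
    + repeat split; eexists; eassumption.
    +
      replace (Derive (fun t => u t) x) with (fst (df x))
        by (symmetry; exact (is_derive_unique _ _ _ F1));
      replace (Derive (fun t => v t) x) with (snd (df x))
        by (symmetry; exact (is_derive_unique _ _ _ F2)). ring.
Qed.

Lemma Cnorm2_neq_0 (z : C) : z <> 0%C -> fst z ^ 2 + snd z ^ 2 <> 0.
Proof.
  intros Hz H. apply Hz. destruct z as [u v]; cbn in H.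
  assert (u = 0) by nra. assert (v = 0) by nra. now subst.
Qed.

Lemma derives_inv (f df : R -> C) :
  derives f df -> (forall x, f x <> 0%C) ->
  derives (fun x => / f x)%C (fun x => - df x * / f x * / f x)%C.
Proof.
  intros Hf Hn x. apply is_derive_C_pair.
  pose proof (derives_Re _ _ Hf x) as F1. pose proof (derives_Im _ _ Hf x) as F2.
  pose proof (Cnorm2_neq_0 _ (Hn x)) as Hx.
  unfold Re, Im in *. unfold Cinv, Cmult, Copp. cbn [fst snd].
  set (u := fun t => fst (f t)) in *. set (v := fun t => snd (f t)) in *.
  change (is_derive u x (fst (df x))) in F1. change (is_derive v x (snd (df x))) in F2.
  change (fst (f x)) with (u x) in *. change (snd (f x)) with (v x) in *.
  split.
  - apply (is_derive_ext (fun t => u t / (u t ^ 2 + v t ^ 2))); [reflexivity|].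
    auto_derive.
    + repeat split; try (eexists; eassumption). cbn in Hx. lra.
    +
      replace (Derive (fun t => u t) x) with (fst (df x))
        by (symmetry; exact (is_derive_unique _ _ _ F1));
      replace (Derive (fun t => v t) x) with (snd (df x))
        by (symmetry; exact (is_derive_unique _ _ _ F2)).
      field. cbn in Hx. lra.
  - apply (is_derive_ext (fun t => - v t / (u t ^ 2 + v t ^ 2))); [reflexivity|].
    auto_derive.
    + repeat split; try (eexists; eassumption).  cbn in Hx. lra.
    +
      replace (Derive (fun t => u t) x) with (fst (df x))
        by (symmetry; exact (is_derive_unique _ _ _ F1));
      replace (Derive (fun t => v t) x) with (snd (df x))
        by (symmetry; exact (is_derive_unique _ _ _ F2)).
      field. cbn in Hx. lra.
Qed.

Lemma derives_CDerive (f df : R -> C) :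
  derives f df -> forall x, CDerive f x = df x.
Proof. intros H x. apply is_CDerive_unique, H. Qed.

Lemma CDerive_ext (f g : R -> C) (x : R) :
  (forall t, f t = g t) -> CDerive f x = CDerive g x.
Proof.
  intros H. unfold CDerive.
  f_equal; apply Derive_ext; intros t; now rewrite H.
Qed.

Lemma Csmooth_derives (f : R -> C) (n : nat) :
  Csmooth f -> derives (CDerive_n f n) (CDerive_n f (S n)).
Proof. intros H x. exact (CDerive_correct _ _ (H n x)). Qed.

Lemma derives_zero_const (f : R -> C) :
  derives f (fun _ => 0%C) -> forall x y, f x = f y.
Proof.
  intros H.
  assert (K : forall g : R -> R, (forall x, is_derive g x 0) -> forall x y, g x = g y).
  { intros g Hg x y.
    destruct (MVT_gen g x y (fun _ => 0)) as [c [_ Hc]].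
    - intros; apply Hg.
    - intros t _. apply continuity_pt_filterlim.
      apply (ex_derive_continuous (V := R_NormedModule)).
      exists 0; apply Hg.
    - lra. }
  intros x y. apply injective_projections.
  - exact (K (fun t => Re (f t)) (derives_Re _ _ H) x y).
  - exact (K (fun t => Im (f t)) (derives_Im _ _ H) x y).
Qed.

(** * Growth and interpolation estimates *)

(* [auto_derive] leaves values [Derive f x] with [f] eta-expanded, which [rewrite] misses. *)
Ltac derive_values :=
  repeat match goal with
  | H : forall x, is_derive _ x _ |- context [Derive ?f ?x] =>
      rewrite (is_derive_unique f x _ (H x))
  end.

Lemma is_derive_MVT (f df : R -> R) (a b : R) :
  (forall x, is_derive f x (df x)) -> a < b ->
  exists c, a < c < b /\ f b - f a = df c * (b - a).
Proof.
  intros H Hab.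
  destruct (MVT_cor2 f df a b Hab) as [c [Hc1 Hc2]].
  - intros c _. apply is_derive_Reals, H.
  - exists c. auto.
Qed.

Lemma is_derive_incr (f df : R -> R) (a b : R) :
  (forall x, is_derive f x (df x)) -> (forall x, a <= x -> 0 <= df x) ->
  a <= b -> f a <= f b.
Proof.
  intros H Hp [Hab | ->]; [|lra].
  destruct (is_derive_MVT f df a b H Hab) as [c [Hc E]].
  assert (0 <= df c) by (apply Hp; lra). nra.
Qed.

Lemma exp_mult_INR (n : nat) (x : R) : exp (INR n * x) = exp x ^ n.
Proof.
  induction n as [|n IH].
  - cbn. rewrite Rmult_0_l. apply exp_0.
  - rewrite S_INR, Rmult_plus_distr_r, exp_plus, IH, Rmult_1_l. cbn. ring.
Qed.

(** With [r = s / m], the exponential is [exp (r * z) ^ m >= (r * z) ^ m], a power of [z] of degree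
    one higher than the polynomial. *)
Lemma exp_beats_poly (s A x0 : R) (k : nat) :
  0 < s -> exists z, x0 <= z /\ A * (1 + z ^ 2) ^ k < exp (s * z).
Proof.
  intros Hs.
  (* One more than the degree [2 * k]: the comparison keeps a spare factor [z]. *)
  set (m := (2 * k + 1)%nat).
  assert (Hm : 0 < INR m) by (apply lt_0_INR; unfold m; lia).
  set (r := s / INR m).
  assert (Hr : 0 < r) by (apply Rdiv_lt_0_compat; assumption).
  assert (Hrm : 0 < r ^ m) by (apply pow_lt; assumption).
  set (B := Rabs A * 2 ^ k).
  assert (HB : 0 <= B).
  { apply Rmult_le_pos; [apply Rabs_pos | apply pow_le; lra]. }
  (* [z >= 1] gives [1 + z ^ 2 <= 2 * z ^ 2], the source of [2 ^ k] in [B]; beyond [B / r ^ m] the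
     spare factor beats the constant. *)
  set (z := Rmax (Rmax x0 1) (B / r ^ m + 1)).
  assert (Hz0 : x0 <= z)
    by (eapply Rle_trans; [apply Rmax_l | apply Rmax_l]).
  assert (Hz1 : 1 <= z)
    by (eapply Rle_trans; [apply Rmax_r | apply Rmax_l]).
  assert (HzB : B / r ^ m + 1 <= z) by apply Rmax_r.
  exists z. split; [assumption|].
  assert (E1 : exp (s * z) = exp (r * z) ^ m).
  { rewrite <- exp_mult_INR. f_equal. unfold r. field. lra. }
  assert (E2 : (r * z) ^ m <= exp (s * z)).
  { rewrite E1. apply pow_incr. split; [nra|].
    pose proof (exp_ineq1_le (r * z)). lra. }
  assert (E3 : (r * z) ^ m = r ^ m * z * (z ^ 2) ^ k).
  { unfold m. rewrite Rpow_mult_distr, (pow_add z), pow_mult. ring. }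
  assert (E4 : A * (1 + z ^ 2) ^ k <= B * (z ^ 2) ^ k).
  { unfold B. rewrite Rmult_assoc, <- Rpow_mult_distr.
    apply Rle_trans with (Rabs A * (1 + z ^ 2) ^ k).
    - apply Rmult_le_compat_r; [apply pow_le; nra | apply Rle_abs].
    - apply Rmult_le_compat_l; [apply Rabs_pos|].
      apply pow_incr. nra. }
  assert (E5 : 0 < (z ^ 2) ^ k) by (apply pow_lt; nra).
  assert (E6 : B < r ^ m * z).
  { apply Rlt_le_trans with (r ^ m * (B / r ^ m + 1)).
    - field_simplify; lra.
    - apply Rmult_le_compat_l; lra. }
  apply Rmult_lt_compat_r with (r := (z ^ 2) ^ k) in E6; lra.
Qed.

Section Growth.
Variables (N N1 N2 : R -> R) (s A : R) (k : nat).
Hypothesis Hs : 0 < s.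
Hypothesis HN : forall x, is_derive N x (N1 x).
Hypothesis HN1 : forall x, is_derive N1 x (N2 x).
Hypothesis Hpos : forall x, 0 <= N x.
Hypothesis Hconv : forall x, s ^ 2 * N x <= N2 x.
Hypothesis Hpoly : forall x, N x <= A * (1 + x ^ 2) ^ k.

(* [(N' + s N) exp(-s z)] is nondecreasing. *)
Lemma exp_growth (x0 : R) : 0 <= N1 x0 -> N x0 = 0.
Proof.
  intros Hx0. destruct (Hpos x0) as [Hc | E]; [exfalso | auto].
  set (c := N x0) in *.
  assert (Y : forall z, x0 <= z ->
            s * c * exp (- s * x0) <= (N1 z + s * N z) * exp (- s * z)).
  { intros z Hz.
    apply Rle_trans with ((N1 x0 + s * N x0) * exp (- s * x0)).
    - apply Rmult_le_compat_r; [left; apply exp_pos | unfold c; lra].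
    - apply (is_derive_incr (fun z => (N1 z + s * N z) * exp (- s * z))
               (fun z => (N2 z - s ^ 2 * N z) * exp (- s * z))); [| |assumption].
      + intros x. auto_derive.
        * repeat split; eexists; eauto.
        * derive_values.
          ring.
      + intros x _. apply Rmult_le_pos; [specialize (Hconv x); lra | left; apply exp_pos]. }
  (* Integrates [Y]: it bounds the derivative of [N z * exp (s * z)] below by
     [s * c * exp (2 * s * z - s * x0)], whose primitive carries the factor [c / 2]. At [x0] the
     difference is still positive. *)
  assert (G : forall z, x0 <= z -> c / 2 * exp (s * (z - x0)) <= N z).
  { intros z Hz.
    pose proof (is_derive_incr
      (fun z => N z * exp (s * z) - c / 2 * exp (2 * s * z - s * x0))
      (fun z => (N1 z + s * N z) * exp (s * z) - s * c * exp (2 * s * z - s * x0))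
      x0 z) as Hm.
    assert (H0 : N x0 * exp (s * x0) - c / 2 * exp (2 * s * x0 - s * x0) <=
                 N z * exp (s * z) - c / 2 * exp (2 * s * z - s * x0)).
    { apply Hm; [| |assumption].
      - intros x. auto_derive.
        + repeat split; eexists; eauto.
        + derive_values. unfold Rminus. field.
      - intros x Hx. specialize (Y x Hx).
        apply Rmult_le_compat_r with (r := exp (2 * s * x)) in Y;
          [|left; apply exp_pos].
        rewrite (Rmult_assoc (s * c)), (Rmult_assoc (N1 x + s * N x)), <- !exp_plus in Y.
        replace (- s * x0 + 2 * s * x) with (2 * s * x - s * x0) in Y by ring.
        replace (- s * x + 2 * s * x) with (s * x) in Y by ring. lra. }
    replace (2 * s * x0 - s * x0) with (s * x0) in H0 by ring.
    change (N x0) with c in H0.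
    pose proof (exp_pos (s * x0)).
    apply Rmult_le_reg_r with (exp (s * z)); [apply exp_pos|].
    rewrite Rmult_assoc, <- exp_plus.
    replace (s * (z - x0) + s * z) with (2 * s * z - s * x0) by ring.
    nra. }
  (* The constant is the one that normalises the lower bound [G] to [exp (s * z)]. *)
  destruct (exp_beats_poly s (2 / c * exp (s * x0) * A) x0 k Hs) as [z [Hz1 Hz2]].
  specialize (G z Hz1). specialize (Hpoly z).
  assert (K : c / 2 * exp (s * (z - x0)) <= A * (1 + z ^ 2) ^ k) by lra.
  apply Rmult_le_compat_l with (r := 2 / c * exp (s * x0)) in K.
  - replace (2 / c * exp (s * x0) * (c / 2 * exp (s * (z - x0))))
      with (exp (s * x0) * exp (s * (z - x0))) in K by (field; lra).
    rewrite <- exp_plus in K.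
    replace (s * x0 + s * (z - x0)) with (s * z) in K by ring. lra.
  - apply Rmult_le_pos; [|left; apply exp_pos].
    apply Rlt_le, Rdiv_lt_0_compat; lra.
Qed.
End Growth.

(** At a point of nonnegative slope a positive value would grow exponentially to the right; at a
    point of negative slope the reflection [t -> - t] reduces to that case. *)
Lemma convex_poly_zero (N N1 N2 : R -> R) (s A : R) (k : nat) :
  0 < s ->
  (forall x, is_derive N x (N1 x)) -> (forall x, is_derive N1 x (N2 x)) ->
  (forall x, 0 <= N x) -> (forall x, s ^ 2 * N x <= N2 x) ->
  (forall x, N x <= A * (1 + x ^ 2) ^ k) ->
  forall x, N x = 0.
Proof.
  intros Hs H H1 Hp Hc Hb x.
  destruct (Rle_dec 0 (N1 x)) as [L | L].
  - exact (exp_growth N N1 N2 s A k Hs H H1 Hp Hc Hb x L).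
  - rewrite <- (Ropp_involutive x) at 1.
    apply (exp_growth (fun t => N (- t)) (fun t => - N1 (- t)) (fun t => N2 (- t)) s A k);
      auto.
    + intros t. auto_derive; [eexists; eauto|].
      derive_values. ring.
    + intros t. auto_derive; [eexists; eauto|].
      derive_values. ring.
    + intros t. replace (t ^ 2) with ((- t) ^ 2) by ring. apply Hb.
    + rewrite Ropp_involutive. lra.
Qed.

(* A second difference quotient of step [h] is a value of [g2], and a first one of step
   [2 h] a value of [g1]; the oscillation of both is controlled by [g3]. *)
Lemma landau_interval (g0 g1 g2 g3 : R -> R) (x h M0 M3 : R) :
  (forall t, is_derive g0 t (g1 t)) -> (forall t, is_derive g1 t (g2 t)) ->
  (forall t, is_derive g2 t (g3 t)) -> 0 < h ->
  (forall t, x <= t <= x + 2 * h -> Rabs (g0 t) <= M0) ->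
  (forall t, x <= t <= x + 2 * h -> Rabs (g3 t) <= M3) ->
  forall y, x <= y <= x + 2 * h ->
    Rabs (g2 y) <= 4 * (M0 / h ^ 2) + 2 * h * M3 /\
    Rabs (g1 y) <= M0 / h + 2 * h * (4 * (M0 / h ^ 2) + 2 * h * M3).
Proof.
  intros D0 D1 D2 Hh B0 B3.
  (* Mean value estimate: one good point [c] controls the function on the whole interval of length
     [2 * h]. *)
  assert (V : forall (f df : R -> R) (c y B : R), (forall t, is_derive f t (df t)) ->
            x <= c <= x + 2 * h -> x <= y <= x + 2 * h ->
            (forall t, x <= t <= x + 2 * h -> Rabs (df t) <= B) ->
            Rabs (f y) <= Rabs (f c) + 2 * h * B).
  { intros f df c y B Hf Hc Hy HB.
    assert (HB0 : 0 <= B) by (eapply Rle_trans; [apply Rabs_pos | apply (HB c Hc)]).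
    destruct (MVT_abs f df c y) as [e [He1 He2]].
    { intros t _. apply is_derive_Reals, Hf. }
    assert (He : x <= e <= x + 2 * h).
    { unfold Rmin, Rmax in He2; destruct (Rle_dec c y); lra. }
    specialize (HB e He).
    assert (Rabs (y - c) <= 2 * h) by (apply Rabs_le; lra).
    pose proof (Rabs_pos (df e)). pose proof (Rabs_pos (y - c)).
    assert (Rabs (f y - f c) <= 2 * h * B) by (rewrite He1; nra).
    replace (f y) with (f c + (f y - f c)) by ring.
    eapply Rle_trans; [apply Rabs_triang|]. lra. }
  assert (C2 : exists c, x <= c <= x + 2 * h /\ Rabs (g2 c) <= 4 * (M0 / h ^ 2)).
  { destruct (is_derive_MVT (fun t => g0 (t + h) - g0 t)
                (fun t => g1 (t + h) - g1 t) x (x + h)) as [c [Hc E]]; [|lra|].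
    { intros t. auto_derive; [repeat split; eexists; eauto|].
      derive_values.
      ring. }
    destruct (is_derive_MVT g1 g2 c (c + h) D1) as [d [Hd E']]; [lra|].
    exists d. split; [lra|].
    rewrite E' in E.
    pose proof (B0 (x + h + h) ltac:(lra)) as b1. pose proof (B0 (x + h) ltac:(lra)) as b2.
    pose proof (B0 x ltac:(lra)) as b3.
    replace (g2 d) with ((g0 (x + h + h) - g0 (x + h) - (g0 (x + h) - g0 x)) / h ^ 2)
      by (rewrite E; field; lra).
    assert (0 < h ^ 2) by (apply pow_lt; lra).
    unfold Rdiv. rewrite Rabs_mult, (Rabs_pos_eq (/ h ^ 2))
      by (left; now apply Rinv_0_lt_compat).
    rewrite <- Rmult_assoc.
    apply Rmult_le_compat_r; [left; now apply Rinv_0_lt_compat|].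
    apply Rabs_le_between in b1, b2, b3. apply Rabs_le. lra. }
  destruct C2 as [c [Hc Hc2]].
  assert (E2 : forall y, x <= y <= x + 2 * h -> Rabs (g2 y) <= 4 * (M0 / h ^ 2) + 2 * h * M3).
  { intros y Hy. pose proof (V g2 g3 c y M3 D2 Hc Hy B3). lra. }
  assert (C1 : exists c, x <= c <= x + 2 * h /\ Rabs (g1 c) <= M0 / h).
  { destruct (is_derive_MVT g0 g1 x (x + 2 * h) D0) as [d [Hd E]]; [lra|].
    exists d. split; [lra|].
    pose proof (B0 (x + 2 * h) ltac:(lra)) as b1. pose proof (B0 x ltac:(lra)) as b2.
    replace (g1 d) with ((g0 (x + 2 * h) - g0 x) / 2 / h) by (rewrite E; field; lra).
    unfold Rdiv at 1. rewrite Rabs_mult, (Rabs_pos_eq (/ h))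
      by (left; now apply Rinv_0_lt_compat).
    apply Rmult_le_compat_r; [left; now apply Rinv_0_lt_compat|].
    apply Rabs_le_between in b1, b2. apply Rabs_le. lra. }
  destruct C1 as [c1 [Hc1 Hc1b]].
  intros y Hy. split; [auto|].
  pose proof (V g1 g2 c1 y _ D1 Hc1 Hy E2). lra.
Qed.

Lemma Cmod_le_Re_Im (z : C) : Cmod z <= Rabs (Re z) + Rabs (Im z).
Proof.
  destruct z as [u v]. replace ((u, v) : C) with (RtoC u + (0, v))%C
    by (apply injective_projections; cbn; ring).
  eapply Rle_trans; [apply Cmod_triangle|]. rewrite Cmod_R. cbn. rewrite Rplus_0_r, Rplus_0_l.
  apply Rplus_le_compat_l. unfold Cmod; cbn.
  replace (0 * (0 * 1) + v * (v * 1)) with (Rsqr v) by (unfold Rsqr; ring).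
  rewrite sqrt_Rsqr_abs. lra.
Qed.

Lemma im_le_Cmod (z : C) : Rabs (Im z) <= Cmod z.
Proof.
  unfold Cmod. rewrite <- sqrt_Rsqr_abs. apply sqrt_le_1_alt.
  unfold Rsqr, Im. nra.
Qed.

(** Interpolation on an interval of length [2 * h] bounds [W1] and [W2] by [M] and the maximum of
    the coordinates of [W3]; the hypothesis bounds [W3] back by [W1] and [W2]. Since [h] is of order
    [/ K], the second derivative costs [M / h ^ 2], hence [K ^ 2]. *)
Lemma third_order_bound (W0 W1 W2 W3 W4 : R -> C) (x M K : R) :
  derives W0 W1 -> derives W1 W2 -> derives W2 W3 -> derives W3 W4 ->
  1 <= K -> (forall t, Cmod (W0 t) <= M) ->
  (forall t, x <= t <= x + 1 -> Cmod (W3 t) <= K * (Cmod (W2 t) + Cmod (W1 t))) ->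
  Cmod (W1 x) <= 30000 * K ^ 2 * M /\ Cmod (W2 x) <= 30000 * K ^ 2 * M.
Proof.
  intros D0 D1 D2 D3 HK HM HW.
  (* The step is small enough for the Landau bound by [W3] to be absorbed. *)
  set (h := / (24 * K)).
  assert (Hh : 0 < h) by (apply Rinv_0_lt_compat; lra).
  assert (HKh : 24 * K * h = 1) by (unfold h; field; lra).
  assert (Hh1 : h <= / 24) by nra.
  assert (HM0 : 0 <= M) by (eapply Rle_trans; [apply Cmod_ge_0 | apply (HM 0)]).
  assert (EM : forall g dg : R -> R, (forall t, is_derive g t (dg t)) ->
     exists c, x <= c <= x + 2 * h /\
       forall t, x <= t <= x + 2 * h -> Rabs (g t) <= Rabs (g c)).
  { intros g dg Hg.
    destruct (continuity_ab_maj (fun t => Rabs (g t)) x (x + 2 * h)) as [c [Hc1 Hc2]].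
    - lra.
    - intros t _. apply (continuity_pt_comp g Rabs).
      + apply continuity_pt_filterlim, (ex_derive_continuous (V := R_NormedModule)).
        eexists; apply Hg.
      + apply Rcontinuity_abs.
    - exists c. auto. }
  destruct (EM _ _ (derives_Re _ _ D3)) as [c1 [Hc1 Bc1]].
  destruct (EM _ _ (derives_Im _ _ D3)) as [c2 [Hc2 Bc2]].
  set (M3 := Rmax (Rabs (Re (W3 c1))) (Rabs (Im (W3 c2)))).
  assert (LR := landau_interval _ _ _ _ x h M M3 (derives_Re _ _ D0)
                  (derives_Re _ _ D1) (derives_Re _ _ D2) Hh
     (fun t _ => Rle_trans _ _ _ (re_le_Cmod _) (HM t))
     (fun t Ht => Rle_trans _ _ _ (Bc1 t Ht) (Rmax_l _ _))).
  assert (LI := landau_interval _ _ _ _ x h M M3 (derives_Im _ _ D0)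
                  (derives_Im _ _ D1) (derives_Im _ _ D2) Hh
     (fun t _ => Rle_trans _ _ _ (im_le_Cmod _) (HM t))
     (fun t Ht => Rle_trans _ _ _ (Bc2 t Ht) (Rmax_r _ _))).
  assert (Eh : / h = 24 * K) by (unfold h; field; lra).
  assert (Eh2 : M / h ^ 2 = 576 * (K ^ 2 * M)).
  { unfold Rdiv. rewrite <- pow_inv, Eh. ring. }
  assert (Eh1 : M / h = 24 * (K * M)).
  { unfold Rdiv. rewrite Eh. ring. }
  rewrite Eh1, Eh2 in LR, LI.
  assert (P1 : 0 <= K * M) by nra.
  assert (P2 : K * M <= K ^ 2 * M) by nra.
  set (Q := K ^ 2 * M) in *.
  assert (HM3 : 0 <= M3) by (eapply Rle_trans; [apply Rabs_pos | apply Rmax_l]).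
  assert (T : forall t, x <= t <= x + 2 * h ->
     Cmod (W2 t) <= 4608 * Q + 4 * h * M3 /\ Cmod (W1 t) <= 432 * Q + 8 * h * M3).
  { intros t Ht.
    destruct (LR t Ht) as [r2 r1]. destruct (LI t Ht) as [i2 i1].
    pose proof (Cmod_le_Re_Im (W2 t)). pose proof (Cmod_le_Re_Im (W1 t)).
    assert (0 <= h * M3) by nra.
    assert (2 * h * (4 * (576 * Q) + 2 * h * M3) <= 192 * Q + 4 * h * M3).
    { assert (h * Q <= / 24 * Q) by (apply Rmult_le_compat_r; lra).
      assert (h * (h * M3) <= / 24 * (h * M3)) by (apply Rmult_le_compat_r; lra).
      lra. }
    split; lra. }
  (* The bounds [T], with 4608 + 432 = 5040, are inserted into the hypothesis at the two maximum
     points. The term in [M3] comes back with factor [12 * K * h = 1 / 2] and is absorbed. *)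
  assert (B3 : M3 <= 2 * K * (5040 * Q)).
  { assert (Hc : forall c, x <= c <= x + 2 * h -> Cmod (W3 c) <= K * (5040 * Q) + M3 / 2).
    { intros c Hc. specialize (HW c ltac:(lra)). destruct (T c Hc) as [t2 t1].
      assert (K * (Cmod (W2 c) + Cmod (W1 c)) <= K * (5040 * Q + 12 * h * M3))
        by (apply Rmult_le_compat_l; lra).
      replace (K * (5040 * Q + 12 * h * M3)) with (K * (5040 * Q) + (24 * K * h) * M3 / 2)
        in H by field.
      rewrite HKh in H. lra. }
    pose proof (Hc c1 Hc1). pose proof (Hc c2 Hc2).
    pose proof (re_le_Cmod (W3 c1)). pose proof (im_le_Cmod (W3 c2)).
    assert (M3 <= K * (5040 * Q) + M3 / 2) by (apply Rmax_lub; lra).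
    lra. }
  assert (B4 : h * M3 <= 420 * Q).
  { apply Rmult_le_compat_l with (r := h) in B3; [|lra].
    replace (h * (2 * K * (5040 * Q))) with ((24 * K * h) * (420 * Q)) in B3 by field.
    rewrite HKh in B3. lra. }
  destruct (T x ltac:(lra)) as [t2 t1].
  (* The constants obtained are 6288 for [W2] and 3792 for [W1]; 30000 is a round bound for both. *)
  replace (30000 * K ^ 2 * M) with (30000 * Q) by (unfold Q; ring).
  assert (0 <= Q) by lra.
  split; lra.
Qed.

(** * The complex Gaussian integral *)

(* Integrals leave equations at the type [C_R_CompleteNormedModule], which [ring] does
   not identify with [C]. *)
Ltac C_ring := match goal with |- ?a = ?b => change (@eq C a b); ring end.

Lemma derives_continuous (f df : R -> C) :
  derives f df -> forall x, continuous (U := C_R_CompleteNormedModule) f x.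
Proof.
  intros H x. apply (ex_derive_continuous (V := C_R_NormedModule)).
  exists (df x). apply H.
Qed.

Lemma derives_RInt (f df : R -> C) :
  derives f df ->
  derives (fun x => RInt (V := C_R_CompleteNormedModule) f 0 x) f.
Proof.
  intros H x.
  apply (is_derive_RInt (V := C_R_NormedModule) f _ 0 x).
  - apply filter_forall. intros y.
    apply (RInt_correct (V := C_R_CompleteNormedModule)).
    apply (ex_RInt_continuous (V := C_R_CompleteNormedModule)).
    intros; eapply derives_continuous, H.
  - eapply derives_continuous, H.
Qed.

Lemma RInt_derives (f df ddf : R -> C) (a b : R) :
  derives f df -> derives df ddf ->
  RInt (V := C_R_CompleteNormedModule) df a b = (f b - f a)%C :> C.
Proof.
  intros H1 H2. apply (is_RInt_unique (V := C_R_CompleteNormedModule)).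
  apply (is_RInt_derive (V := C_R_CompleteNormedModule) f df).
  - intros; apply H1.
  - intros; eapply derives_continuous, H2.
Qed.

Lemma RInt_C_pair (f df : R -> C) (a b : R) :
  derives f df ->
  RInt (V := C_R_CompleteNormedModule) f a b =
  (RInt (fun t => Re (f t)) a b, RInt (fun t => Im (f t)) a b) :> C.
Proof.
  intros H. apply (is_RInt_unique (V := C_R_CompleteNormedModule)).
  apply (is_RInt_fct_extend_pair (U := R_NormedModule) (V := R_NormedModule));
    apply (RInt_correct (V := R_CompleteNormedModule)), ex_RInt_continuous; intros t _;
    apply (ex_derive_continuous (V := R_NormedModule)); eexists.
  - apply (derives_Re _ _ H).
  - apply (derives_Im _ _ H).
Qed.

Lemma derives_comp_scal (f df : R -> C) (z : R) :
  derives f df -> derives (fun t => f (t * z)) (fun t => RtoC z * df (t * z)%R)%C.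
Proof.
  intros H x.
  assert (Hz : is_derive (fun t => t * z) x z).
  { auto_derive; [exact I | ring]. }
  pose proof (is_derive_comp (V := C_R_NormedModule) f (fun t => t * z) x _ _
                (H (x * z)) Hz) as D.
  refine (eq_rect _ (fun l => is_derive (V := C_R_NormedModule) _ x l) D _ _).
  apply injective_projections; cbn; ring.
Qed.

Lemma Cexp_plus (a b : C) : Cexp (a + b)%C = (Cexp a * Cexp b)%C.
Proof.
  destruct a as [a1 a2], b as [b1 b2].
  apply injective_projections; cbn;
    rewrite exp_plus, ?cos_plus, ?sin_plus; ring.
Qed.

Lemma Cexp_0 : Cexp 0%C = 1%C.
Proof. apply injective_projections; cbn; rewrite exp_0, ?cos_0, ?sin_0; ring. Qed.

Lemma Cmod_Cexp (z : C) : Cmod (Cexp z) = exp (Re z).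
Proof.
  unfold Cmod, Cexp. cbn [fst snd].
  replace ((exp (Re z) * cos (Im z)) ^ 2 + (exp (Re z) * sin (Im z)) ^ 2)
    with (Rsqr (exp (Re z))).
  - apply sqrt_Rsqr. left; apply exp_pos.
  - pose proof (sin2_cos2 (Im z)) as S. unfold Rsqr in *.
    transitivity (exp (Re z) * exp (Re z) *
                  (sin (Im z) * sin (Im z) + cos (Im z) * cos (Im z))).
    + rewrite S. ring.
    + ring.
Qed.

Lemma Cmod_norm_R (z : C) : norm (V := C_R_NormedModule) z = Cmod z.
Proof.
  destruct z as [u v]. cbn. unfold prod_norm, Cmod. cbn.
  unfold abs; cbn. rewrite !Rmult_1_r, <- !Rabs_mult, !Rabs_pos_eq by nra. reflexivity.
Qed.

Lemma exp_le (x y : R) : x <= y -> exp x <= exp y.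
Proof. intros [L | ->]; [left; now apply exp_increasing | lra]. Qed.

(** The function [P] of the overview: the integral of [exp (- w ^ 2)] along the ray of direction
    [k], parametrised by the real line. *)
Definition gauss_int (k : C) (z : R) : C :=
  RInt (V := C_R_CompleteNormedModule)
    (fun s => k * Cexp (- (k * RtoC s) ^ 2))%C 0 z.

Lemma derives_gaussian (c : C) :
  derives (fun s => Cexp (c * RtoC s ^ 2)%C)
          (fun s => 2 * c * RtoC s * Cexp (c * RtoC s ^ 2))%C.
Proof.
  refine (derives_ext _ _ _ _ (derives_exp _ _
    (derives_cmul c _ _ (derives_mult _ _ _ _ derives_id derives_id))) _ _).
  - intros x. f_equal. ring.
  - intros x. cbn beta. replace (c * (x * x))%C with (c * RtoC x ^ 2)%C by ring. ring.
Qed.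

Lemma derives_gauss_integrand (k : C) :
  derives (fun s => k * Cexp (- (k * RtoC s) ^ 2))%C
          (fun s => k * (2 * - (k * k) * RtoC s * Cexp (- (k * k) * RtoC s ^ 2)))%C.
Proof.
  refine (derives_ext _ _ _ _ (derives_cmul k _ _ (derives_gaussian (- (k * k))%C)) _ _).
  - intros x. f_equal. f_equal. ring.
  - intros x. ring.
Qed.

Arguments gauss_int : simpl never.

Lemma derives_gauss_int (k : C) :
  derives (gauss_int k) (fun s => k * Cexp (- (k * RtoC s) ^ 2))%C.
Proof. exact (derives_RInt _ _ (derives_gauss_integrand k)). Qed.

Lemma gauss_int_0 (k : C) : gauss_int k 0 = 0%C.
Proof. exact (RInt_point (V := C_R_CompleteNormedModule) 0 _). Qed.

(** The substitution [s = t * z] in the segment integral, valid for either sign of [z]; it is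
    carried out by recognising the integrand as the derivative of [gauss_int k (t * z)] in [t]. *)
Lemma Cerf_gauss_int (k : C) (z : R) :
  Cerf (k * RtoC z) = (RtoC (2 / sqrt PI) * gauss_int k z)%C.
Proof.
  unfold Cerf. f_equal.
  assert (D1 := derives_comp_scal _ _ z (derives_gauss_int k)).
  assert (D2 := derives_cmul (RtoC z) _ _
                  (derives_comp_scal _ _ z (derives_gauss_integrand k))).
  transitivity (RInt (V := C_R_CompleteNormedModule)
     (fun t => RtoC z * (k * Cexp (- (k * RtoC (t * z)%R) ^ 2)))%C 0 1).
  - apply (RInt_ext (V := C_R_CompleteNormedModule)). intros t _.
    rewrite RtoC_mult.
    replace (- (RtoC t * (k * RtoC z)) ^ 2)%C
      with (- (k * (RtoC t * RtoC z)) ^ 2)%C by ring.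
    C_ring.
  - rewrite (RInt_derives _ _ _ 0 1 D1 D2). cbn beta.
    rewrite Rmult_0_l, Rmult_1_l, gauss_int_0. C_ring.
Qed.

Lemma is_derive_RInt_param_everywhere (f df : R -> R -> R) :
  (forall u t, is_derive (fun v => f v t) u (df u t)) ->
  (forall u t, continuity_2d_pt df u t) ->
  (forall u, ex_RInt (f u) 0 1) ->
  forall u, is_derive (fun v => RInt (f v) 0 1) u (RInt (df u) 0 1).
Proof.
  intros H Hc Hi u.
  rewrite (RInt_ext (df u) (fun t => Derive (fun v => f v t) u)).
  - apply (is_derive_RInt_param f 0 1 u).
    + apply filter_forall. intros v t _. eexists; apply H.
    + intros t _. apply (continuity_2d_pt_ext df); [|apply Hc].
      intros x y. symmetry. apply is_derive_unique, H.
    + apply filter_forall. exact Hi.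
  - intros t _. symmetry. apply is_derive_unique, H.
Qed.

Lemma one_plus_sqr_C_neq_0 (t : R) : (1 + RtoC t ^ 2)%C <> 0%C.
Proof. intros H. apply (f_equal fst) in H. cbn in H. nra. Qed.

Section Gauss.
Variable k : C.
Hypothesis Hk : 0 < Re k.
Hypothesis Hk2 : 0 < Re (k * k)%C.

(** The classical one-variable evaluation of the Gaussian integral, with a complex parameter: at
    [u = 0] the integral over [t] is an arctangent, and differentiation in [u] cancels the
    denominator. *)
Let companion_integrand (u t : R) : C :=
  (/ (1 + RtoC t ^ 2) * Cexp (- (k * k) * (1 + RtoC t ^ 2) * RtoC u ^ 2))%C.

Let companion_integrand' (u t : R) : C :=
  (- (2 * (k * k)) * RtoC u * Cexp (- (k * k) * (1 + RtoC t ^ 2) * RtoC u ^ 2))%C.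

Let companion (u : R) : C := RInt (V := C_R_CompleteNormedModule) (companion_integrand u) 0 1.

Lemma derives_companion_integrand (t : R) :
  derives (fun u => companion_integrand u t) (fun u => companion_integrand' u t).
Proof.
  refine (derives_ext _ _ _ _
    (derives_cmul (/ (1 + RtoC t ^ 2)) _ _
       (derives_gaussian (- (k * k) * (1 + RtoC t ^ 2)))) _ _).
  - intros u. reflexivity.
  - intros u. unfold companion_integrand'. field. apply one_plus_sqr_C_neq_0.
Qed.

Lemma derives_companion_integrand_snd (u : R) : exists df, derives (companion_integrand u) df.
Proof.
  assert (Dq : derives (fun t => 1 + RtoC t ^ 2)%C (fun t => 2 * RtoC t)%C).
  { refine (derives_ext _ _ _ _ (derives_plus _ _ _ _ (derives_const 1%C)
      (derives_mult _ _ _ _ derives_id derives_id)) _ _); intros x; ring. }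
  eexists.
  exact (derives_mult _ _ _ _ (derives_inv _ _ Dq one_plus_sqr_C_neq_0)
    (derives_exp _ _ (derives_mult _ _ _ _ (derives_cmul (- (k * k))%C _ _ Dq)
        (derives_const (RtoC u ^ 2)%C)))).
Qed.

(** Real formulas from which the joint continuity in [(u, t)], required for differentiation under
    the integral, can be read off. *)
Lemma companion_integrand'_coords (u t : R) :
  companion_integrand' u t =
  (let p := Re (k * k)%C in let q := Im (k * k)%C in
   let s := (1 + t * t) * (u * u) in
   (- 2 * u * (exp (- p * s) * (p * cos (q * s) + q * sin (q * s))),
    - 2 * u * (exp (- p * s) * (q * cos (q * s) - p * sin (q * s))))).
Proof.
  unfold companion_integrand'. destruct (k * k)%C as [p q].
  assert (E : (- ((p, q) : C) * (1 + RtoC t ^ 2) * RtoC u ^ 2)%C =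
     ((- p * ((1 + t * t) * (u * u)), - (q * ((1 + t * t) * (u * u)))) : C)).
  { apply injective_projections; cbn; ring. }
  rewrite E. unfold Cexp, Re, Im. cbn [fst snd]. rewrite cos_neg, sin_neg.
  apply injective_projections; cbn; ring.
Qed.

Lemma continuity_2d_companion_integrand' (u t : R) :
  continuity_2d_pt (fun u t => Re (companion_integrand' u t)) u t /\
  continuity_2d_pt (fun u t => Im (companion_integrand' u t)) u t.
Proof.
  set (p := Re (k * k)%C). set (q := Im (k * k)%C).
  assert (S : continuity_2d_pt (fun u t => (1 + t * t) * (u * u)) u t).
  { repeat first [ apply continuity_2d_pt_mult | apply continuity_2d_pt_plus
                 | apply continuity_2d_pt_const | apply continuity_2d_pt_id1
                 | apply continuity_2d_pt_id2 ]. }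
  assert (Ecp : continuity_2d_pt (fun u t => exp (- p * ((1 + t * t) * (u * u)))) u t).
  { apply (continuity_1d_2d_pt_comp exp).
    - apply derivable_continuous_pt, derivable_pt_exp.
    - apply continuity_2d_pt_mult; [apply continuity_2d_pt_const | exact S]. }
  assert (Cc : continuity_2d_pt (fun u t => cos (q * ((1 + t * t) * (u * u)))) u t).
  { apply (continuity_1d_2d_pt_comp cos).
    - apply continuity_cos.
    - apply continuity_2d_pt_mult; [apply continuity_2d_pt_const | exact S]. }
  assert (Sc : continuity_2d_pt (fun u t => sin (q * ((1 + t * t) * (u * u)))) u t).
  { apply (continuity_1d_2d_pt_comp sin).
    - apply continuity_sin.
    - apply continuity_2d_pt_mult; [apply continuity_2d_pt_const | exact S]. }
  split.
  - apply (continuity_2d_pt_ext (fun u t => - 2 * u * (exp (- p * ((1 + t * t) * (u * u)))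
       * (p * cos (q * ((1 + t * t) * (u * u))) + q * sin (q * ((1 + t * t) * (u * u))))))).
    + intros x y. rewrite companion_integrand'_coords. reflexivity.
    + repeat first [ assumption | apply continuity_2d_pt_mult | apply continuity_2d_pt_plus
                 | apply continuity_2d_pt_const | apply continuity_2d_pt_id1 ].
  - apply (continuity_2d_pt_ext (fun u t => - 2 * u * (exp (- p * ((1 + t * t) * (u * u)))
       * (q * cos (q * ((1 + t * t) * (u * u))) - p * sin (q * ((1 + t * t) * (u * u))))))).
    + intros x y. rewrite companion_integrand'_coords. reflexivity.
    + repeat first [ assumption | apply continuity_2d_pt_mult | apply continuity_2d_pt_minus
                 | apply continuity_2d_pt_const | apply continuity_2d_pt_id1 ].
Qed.

(** A primitive in [t]: the exponential splits into a factor free of [t] and the Gaussian at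
    [t * u]. Evaluated between 0 and 1 it gives minus the derivative of [P ^ 2]. The second half
    makes the integrand continuous. *)
Lemma derives_companion_integrand'_snd (u : R) :
  derives (fun t => - (2 * k) * Cexp (- (k * k) * RtoC u ^ 2) * gauss_int k (t * u)%R)%C
          (companion_integrand' u) /\
  exists ddf, derives (companion_integrand' u) ddf.
Proof.
  assert (E : forall t, ((- (2 * k) * Cexp (- (k * k) * RtoC u ^ 2)) *
      (RtoC u * (k * Cexp (- (k * RtoC (t * u)%R) ^ 2))))%C = companion_integrand' u t).
  { intros t. unfold companion_integrand'.
    replace (- (k * k) * (1 + RtoC t ^ 2) * RtoC u ^ 2)%C
      with (- (k * k) * RtoC u ^ 2 + - (k * RtoC (t * u)%R) ^ 2)%C
      by (rewrite RtoC_mult; ring).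
    rewrite Cexp_plus. ring. }
  split; [| eexists].
  - refine (derives_ext _ _ _ _
      (derives_cmul (- (2 * k) * Cexp (- (k * k) * RtoC u ^ 2)) _ _
         (derives_comp_scal _ _ u (derives_gauss_int k))) _ E).
    intros t; reflexivity.
  - refine (derives_ext _ _ _ _
      (derives_cmul (- (2 * k) * Cexp (- (k * k) * RtoC u ^ 2)) _ _
         (derives_cmul (RtoC u) _ _
           (derives_comp_scal _ _ u (derives_gauss_integrand k)))) E _).
    intros t; reflexivity.
Qed.

Lemma derives_companion :
  derives companion (fun u => - (2 * k) * Cexp (- (k * k) * RtoC u ^ 2) * gauss_int k u)%C.
Proof.
  assert (I : forall u, ex_RInt (fun t => Re (companion_integrand u t)) 0 1 /\
                        ex_RInt (fun t => Im (companion_integrand u t)) 0 1).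
  { intros u. destruct (derives_companion_integrand_snd u) as [df D].
    split; apply (ex_RInt_continuous (V := R_CompleteNormedModule)); intros t _;
    apply (ex_derive_continuous (V := R_NormedModule)); eexists.
    - apply (derives_Re _ _ D).
    - apply (derives_Im _ _ D). }
  pose proof (is_derive_RInt_param_everywhere (fun u t => Re (companion_integrand u t))
    (fun u t => Re (companion_integrand' u t)) (fun u t => derives_Re _ _ (derives_companion_integrand t) u)
    (fun u t => proj1 (continuity_2d_companion_integrand' u t)) (fun u => proj1 (I u))) as D1.
  pose proof (is_derive_RInt_param_everywhere (fun u t => Im (companion_integrand u t))
    (fun u t => Im (companion_integrand' u t)) (fun u t => derives_Im _ _ (derives_companion_integrand t) u)
    (fun u t => proj2 (continuity_2d_companion_integrand' u t)) (fun u => proj2 (I u))) as D2.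
  apply (derives_ext
    (fun u => (RInt (fun t => Re (companion_integrand u t)) 0 1,
               RInt (fun t => Im (companion_integrand u t)) 0 1) : C)
    (fun u => (RInt (fun t => Re (companion_integrand' u t)) 0 1,
               RInt (fun t => Im (companion_integrand' u t)) 0 1) : C)).
  - intros u. apply is_derive_C_pair. split; [apply D1 | apply D2].
  - intros u. destruct (derives_companion_integrand_snd u) as [df D].
    symmetry. exact (RInt_C_pair _ _ 0 1 D).
  - intros u. destruct (derives_companion_integrand'_snd u) as [D [ddf DD]].
    rewrite <- (RInt_C_pair _ _ 0 1 DD), (RInt_derives _ _ _ 0 1 D DD).
    rewrite Rmult_0_l, Rmult_1_l, gauss_int_0. C_ring.
Qed.

Lemma RInt_atan (c : R) : is_RInt (fun t => c * / (1 + t ^ 2)) 0 1 (c * (PI / 4)).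
Proof.
  replace (c * (PI / 4)) with (minus (c * atan 1) (c * atan 0))
    by (rewrite atan_1, atan_0; cbn; ring).
  apply (is_RInt_derive (fun t => c * atan t)).
  - intros x _. apply is_derive_Reals.
    apply (derivable_pt_lim_scal atan).
    apply derivable_pt_lim_atan.
  - intros x _. apply (ex_derive_continuous (V := R_NormedModule)).
    auto_derive. nra.
Qed.

Lemma companion_0 : companion 0 = RtoC (PI / 4).
Proof.
  unfold companion.
  destruct (derives_companion_integrand_snd 0) as [df D].
  assert (E : forall t, companion_integrand 0 t = RtoC (1 * / (1 + t ^ 2))).
  { intros t. unfold companion_integrand.
assert (X : (- (k * k) * (1 + RtoC t ^ 2) * RtoC 0 ^ 2)%C = 0%C) by ring.
    rewrite X.
    rewrite Cexp_0, Rmult_1_l, RtoC_inv by nra. rewrite RtoC_plus, RtoC_pow. ring. }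
  rewrite (RInt_C_pair _ _ 0 1 D).
  apply injective_projections; cbn [fst snd RtoC].
  - rewrite (RInt_ext _ (fun t => 1 * / (1 + t ^ 2))).
    + rewrite (is_RInt_unique _ _ _ _ (RInt_atan 1)). ring.
    + intros t _. now rewrite E.
  - rewrite (RInt_ext _ (fun t => 0)).
    + rewrite RInt_const. cbn. unfold mult; cbn. ring.
    + intros t _. now rewrite E.
Qed.

(** The derivatives of the two summands cancel, and at 0 only the arctangent value remains. *)
Lemma gauss_int_sqr (u : R) :
  (gauss_int k u * gauss_int k u + companion u)%C = RtoC (PI / 4).
Proof.
  rewrite <- companion_0.
  replace (companion 0) with (gauss_int k 0 * gauss_int k 0 + companion 0)%C
    by (rewrite gauss_int_0; ring).
  apply (derives_zero_const (fun u => gauss_int k u * gauss_int k u + companion u)%C).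
  refine (derives_ext _ _ _ _ (derives_plus _ _ _ _
    (derives_mult _ _ _ _ (derives_gauss_int k) (derives_gauss_int k)) derives_companion) _ _).
  - reflexivity.
  - intros x. cbn beta.
    replace (- (k * RtoC x) ^ 2)%C with (- (k * k) * RtoC x ^ 2)%C by ring. ring.
Qed.

(** Since [1 + t ^ 2 >= 1] and [Re (k * k) > 0], the exponential factor is at most its value at
    [t = 0]; what remains integrates to [PI / 4]. *)
Lemma companion_bound (u : R) : Cmod (companion u) <= exp (- Re (k * k)%C * u ^ 2) * (PI / 4).
Proof.
  set (c := exp (- Re (k * k)%C * u ^ 2)).
  destruct (derives_companion_integrand_snd u) as [df D].
  assert (E : forall t, Cmod (companion_integrand u t) <= c * / (1 + t ^ 2)).
  { intros t. unfold companion_integrand. rewrite Cmod_mult, Cmod_inv, Rmult_comm by apply one_plus_sqr_C_neq_0.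
    assert (Et : (1 + RtoC t ^ 2)%C = RtoC (1 + t ^ 2)) by now rewrite RtoC_plus, RtoC_pow.
    rewrite Et, Cmod_R, Rabs_pos_eq by nra.
    apply Rmult_le_compat_r; [left; apply Rinv_0_lt_compat; nra|].
    rewrite Cmod_Cexp. unfold c. apply exp_le.
    destruct (k * k)%C as [p q]. cbn in Hk2 |- *.
    assert (0 <= t ^ 2 * u ^ 2) by nra. nra. }
  rewrite <- Cmod_norm_R.
  apply (norm_RInt_le (V := C_R_NormedModule) (companion_integrand u)
           (fun t => c * / (1 + t ^ 2)) 0 1).
  - lra.
  - intros t _. rewrite Cmod_norm_R. apply E.
  - apply (RInt_correct (V := C_R_CompleteNormedModule)),
      (ex_RInt_continuous (V := C_R_CompleteNormedModule)).
    intros t _. eapply derives_continuous, D.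
  - apply RInt_atan.
Qed.

(* [Re (P^2) > 0] for [u > 0], so [Re P] has no zero there; it is positive near [0]
   because its derivative at [0] is [Re k]. *)
Lemma Re_gauss_int_pos (u : R) : 0 < u -> 0 < Re (gauss_int k u).
Proof.
  intros Hu. apply Rnot_le_lt. intros Hneg.
  assert (NZ : forall x, 0 < x -> Re (gauss_int k x) <> 0).
  { intros x Hx E0.
    pose proof (f_equal fst (gauss_int_sqr x)) as S.
    pose proof (re_le_Cmod (companion x)) as B. pose proof (companion_bound x) as B'.
    (* Strictness here puts the modulus of [companion x] below [PI / 4], whereas [Re P = 0] would
       make the real part of [P ^ 2] nonpositive. *)
    assert (L : exp (- Re (k * k)%C * x ^ 2) < 1).
    { rewrite <- exp_0. apply exp_increasing. assert (0 < x ^ 2) by nra. nra. }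
    pose proof PI_RGT_0. apply Rabs_le_between in B.
    unfold Re in *. unfold Cplus, Cmult, RtoC in S. cbn [fst snd] in S.
    rewrite E0 in S. nra. }
  assert (D := derives_Re _ _ (derives_gauss_int k)).
  set (g := fun s => Re (k * Cexp (- (k * RtoC s) ^ 2))%C) in D.
  assert (Cg : continuous g 0).
  { apply (ex_derive_continuous (V := R_NormedModule)). eexists.
    apply (derives_Re _ _ (derives_gauss_integrand k)). }
  assert (g0 : 0 < g 0).
  { unfold g. assert (X : (- (k * RtoC 0) ^ 2)%C = 0%C) by ring.
    rewrite X, Cexp_0, Cmult_1_r. exact Hk. }
  destruct (Cg (fun y => 0 < y) (open_gt 0 (g 0) g0)) as [d Hd].
  (* Below [d] the derivative of [Re P] is positive, so [Re P] is positive at [e]; [e <= u] allows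
     the intermediate value theorem between [e] and [u]. *)
  set (e := Rmin (d / 2) u).
  assert (He : 0 < e) by (apply Rmin_glb_lt; [destruct d; cbn; lra | assumption]).
  assert (He1 : e <= d / 2) by apply Rmin_l.
  assert (He2 : e <= u) by apply Rmin_r.
  assert (Pe : 0 < Re (gauss_int k e)).
  { destruct (is_derive_MVT _ _ 0 e D He) as [c [Hc Ec]].
    rewrite gauss_int_0 in Ec.
    assert (0 < g c).
    { apply Hd. change (Rabs (c - 0) < d). rewrite Rabs_pos_eq; lra. }
    change (Re (gauss_int k e) - 0 = g c * (e - 0)) in Ec. nra. }
  destruct (IVT_gen (fun s => Re (gauss_int k s)) e u 0) as [x [Hx Ex]].
  - intros s. apply continuity_pt_filterlim, (ex_derive_continuous (V := R_NormedModule)).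
    eexists. apply D.
  - rewrite Rmin_right, Rmax_left by lra. lra.
  - rewrite Rmin_left in Hx by lra. apply (NZ x); [lra | exact Ex].
Qed.

(** With [s = sqrt PI / 2], the identity factors as [(P - s) * (P + s) = - companion]. Positivity of
    [Re P] keeps the second factor at least [/ 4] in modulus, and dividing by it gives the constant
    [4 * (PI / 4)]. *)
Lemma gauss_int_dist (u : R) : 0 < u ->
  Cmod (gauss_int k u - RtoC (sqrt PI / 2)) <= PI * exp (- Re (k * k)%C * u ^ 2).
Proof.
  intros Hu.
  set (s := sqrt PI / 2).
  assert (HPI : 3 < PI) by (pose proof PI2_3_2; lra).
  assert (Hs : / 4 < s).
  { unfold s. assert (1 < sqrt PI); [|lra].
    rewrite <- sqrt_1. apply sqrt_lt_1; lra. }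
  assert (E : ((gauss_int k u - RtoC s) * (gauss_int k u + RtoC s) = - companion u)%C).
  { assert (S : (RtoC s * RtoC s)%C = RtoC (PI / 4)).
    { rewrite <- RtoC_mult. f_equal. unfold s.
      replace (sqrt PI / 2 * (sqrt PI / 2)) with (sqrt PI * sqrt PI / 4) by field.
      rewrite sqrt_sqrt; lra. }
    transitivity (gauss_int k u * gauss_int k u - RtoC s * RtoC s)%C; [ring|].
    rewrite S, <- (gauss_int_sqr u). ring. }
  apply (f_equal Cmod) in E. rewrite Cmod_mult, Cmod_opp in E.
  pose proof (companion_bound u) as B. rewrite <- E in B.
  pose proof (re_le_Cmod (gauss_int k u + RtoC s)) as L.
  pose proof (Re_gauss_int_pos u Hu) as P.
  assert (L' : / 4 <= Cmod (gauss_int k u + RtoC s)).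
  { eapply Rle_trans; [|exact L]. eapply Rle_trans; [|apply Rle_abs].
    unfold Re in *. cbn. lra. }
  pose proof (Cmod_ge_0 (gauss_int k u - RtoC s)).
  nra.
Qed.
End Gauss.

(** The integrand is even, so [P (- u) + P u] has derivative zero. *)
Lemma gauss_int_opp (k : C) (u : R) : gauss_int k (- u) = (- gauss_int k u)%C.
Proof.
  assert (E : (gauss_int k (- u) + gauss_int k u =
               gauss_int k (- 0) + gauss_int k 0)%C).
  { apply (derives_zero_const (fun u => gauss_int k (- u) + gauss_int k u)%C).
    refine (derives_ext _ _ _ _ (derives_plus _ _ _ _
      (derives_comp_scal _ _ (-1) (derives_gauss_int k)) (derives_gauss_int k)) _ _).
    - intros x. cbn beta. do 2 f_equal. ring.
    - intros x. cbn beta. rewrite RtoC_mult.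
      replace (- (k * (RtoC x * RtoC (-1))) ^ 2)%C with (- (k * RtoC x) ^ 2)%C
        by (apply injective_projections; cbn; ring).
      apply injective_projections; cbn; ring. }
  rewrite Ropp_0, gauss_int_0 in E.
  replace (gauss_int k (- u)) with (gauss_int k (- u) + gauss_int k u - gauss_int k u)%C
    by ring.
  rewrite E. ring.
Qed.

(** * Uniqueness of tau *)

Definition omega : C := (/ sqrt 2, / sqrt 2).

Lemma inv_sqrt2_sqr : / sqrt 2 * / sqrt 2 = / 2.
Proof. rewrite <- Rinv_mult, sqrt_sqrt; lra. Qed.

Lemma inv_sqrt2_pos : 0 < / sqrt 2.
Proof. apply Rinv_0_lt_compat, sqrt_lt_R0; lra. Qed.

Lemma omega_sqr : (omega * omega)%C = Ci.
Proof.
  pose proof inv_sqrt2_sqr. apply injective_projections; cbn; lra.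
Qed.

Lemma Ci_sqr : (Ci * Ci)%C = (- (1))%C.
Proof. apply injective_projections; cbn; ring. Qed.

Lemma Cmult_integral (x y : C) : (x * y = 0)%C -> x = 0%C \/ y = 0%C.
Proof.
  intros E. destruct (Ceq_dec x 0) as [Hx | Hx]; [now left|].
  destruct (Ceq_dec y 0) as [Hy | Hy]; [now right|].
  exfalso. exact (Cmult_neq_0 x y Hx Hy E).
Qed.

Lemma omega_neq_0 : omega <> 0%C.
Proof.
  intros E. apply (f_equal fst) in E. cbn in E. pose proof inv_sqrt2_pos. lra.
Qed.

Lemma Cmod_omega : Cmod omega = 1.
Proof.
  unfold Cmod, omega. cbn [fst snd]. pose proof inv_sqrt2_sqr.
  replace ((/ sqrt 2) ^ 2 + (/ sqrt 2) ^ 2) with 1 by lra. apply sqrt_1.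
Qed.

Lemma Cmod_Ci : Cmod Ci = 1.
Proof. unfold Cmod, Ci. cbn [fst snd]. replace (0 ^ 2 + 1 ^ 2) with 1 by ring. apply sqrt_1. Qed.

(** [Rbar_locally'] is the filter of [is_lim]; at the two infinities it is convertible with the
    [Rbar_locally] of [shear_layer_solution]. *)
Lemma filterlim_C_pair (F : Rbar) (f : R -> C) (l : C) :
  filterlim f (Rbar_locally' F) (locally (T := C_UniformSpace) l) <->
  is_lim (fun x => Re (f x)) F (Re l) /\ is_lim (fun x => Im (f x)) F (Im l).
Proof.
  split.
  - intros H. split; intros P [e He].
    + apply (H (fun c : C => P (Re c))). exists e. intros y Hy. apply He, Hy.
    + apply (H (fun c : C => P (Im c))). exists e. intros y Hy. apply He, Hy.
  - intros [H1 H2]. apply filterlim_locally. intros e.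
    generalize (filter_and _ _ (proj1 (filterlim_locally _ _) H1 e)
                  (proj1 (filterlim_locally _ _) H2 e)).
    apply filter_imp. intros x [B1 B2]. split; assumption.
Qed.

Lemma bounded_of_limits (f : R -> R) (l1 l2 : R) :
  (forall x, continuity_pt f x) -> is_lim f m_infty l1 -> is_lim f p_infty l2 ->
  exists M, forall x, Rabs (f x) <= M.
Proof.
  intros Hc H1 H2. apply is_lim_spec in H1, H2.
  destruct (H1 (mkposreal 1 Rlt_0_1)) as [a Ha].
  destruct (H2 (mkposreal 1 Rlt_0_1)) as [b Hb]. cbn in Ha, Hb.
  set (a' := Rmin a b - 1). set (b' := Rmax a b + 1).
  assert (La : a' < a) by (unfold a'; pose proof (Rmin_l a b); lra).
  assert (Lb : b < b') by (unfold b'; pose proof (Rmax_r a b); lra).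
  assert (Lab : a' <= b') by
    (unfold a', b'; pose proof (Rmin_l a b); pose proof (Rmax_l a b); lra).
  destruct (continuity_ab_maj (fun x => Rabs (f x)) a' b' Lab) as [c [Hc1 _]].
  { intros x _. apply (continuity_pt_comp f Rabs); [apply Hc | apply Rcontinuity_abs]. }
  exists (Rabs (f c) + (Rabs l1 + 1) + (Rabs l2 + 1)). intros x.
  pose proof (Rabs_pos (f c)). pose proof (Rabs_pos l1). pose proof (Rabs_pos l2).
  destruct (Rlt_le_dec x a') as [L | L]; [|destruct (Rlt_le_dec b' x) as [L' | L']].
  - specialize (Ha x ltac:(lra)). pose proof (Rabs_triang (f x - l1) l1).
    replace (f x - l1 + l1) with (f x) in * by ring. lra.
  - specialize (Hb x ltac:(lra)). pose proof (Rabs_triang (f x - l2) l2).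
    replace (f x - l2 + l2) with (f x) in * by ring. lra.
  - specialize (Hc1 x ltac:(lra)). lra.
Qed.

(** * The equation for an arbitrary solution and its ladder transform *)

Lemma derives_shear (tau : C) :
  derives (fun z => tau - RtoC z ^ 2)%C (fun z => - (2 * RtoC z))%C.
Proof.
  refine (derives_ext _ _ _ _ (derives_minus _ _ _ _ (derives_const tau)
    (derives_mult _ _ _ _ derives_id derives_id)) _ _); intros x; ring.
Qed.

(** Leibniz rule: the factor [tau - z ^ 2] has derivatives [- 2 z], [- 2] and 0, and the binomial
    coefficients 3 and 3 turn these into 6 and 6. *)
Lemma CDerive_3_shear_mult (tau : C) (W W1 W2 W3 : R -> C) :
  derives W W1 -> derives W1 W2 -> derives W2 W3 ->
  forall z, CDerive_n (fun y => (tau - RtoC y ^ 2) * W y)%C 3 z =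
    ((tau - RtoC z ^ 2) * W3 z - 6 * RtoC z * W2 z - 6 * W1 z)%C.
Proof.
  intros D0 D1 D2. cbn [CDerive_n].
  assert (E1 := derives_CDerive _ _ (derives_mult _ _ _ _ (derives_shear tau) D0)).
  assert (E2 := derives_CDerive _ _ (derives_plus _ _ _ _
    (derives_mult _ _ _ _ (derives_cmul (- (2))%C _ _ derives_id) D0)
    (derives_mult _ _ _ _ (derives_shear tau) D1))).
  assert (E3 := derives_CDerive _ _ (derives_plus _ _ _ _
    (derives_plus _ _ _ _
      (derives_cmul (- (2))%C _ _ D0)
      (derives_cmul (- (4))%C _ _ (derives_mult _ _ _ _ derives_id D1)))
    (derives_mult _ _ _ _ (derives_shear tau) D2))).
  intros z.
  erewrite CDerive_ext; [|intros t; erewrite CDerive_ext; [|exact E1]].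
  2: { erewrite CDerive_ext; [exact (E2 t)|]. intros s. cbn beta. ring. }
  erewrite CDerive_ext; [rewrite E3|]; intros; cbn beta; ring.
Qed.

Section Solution.
Variables (tau : C) (W : R -> C).
Hypothesis Htau : Im tau < 0.
Hypothesis Hsol : shear_layer_solution tau W.

Let W1 := CDerive_n W 1.
Let W2 := CDerive_n W 2.
Let W3 := CDerive_n W 3.
Let a (z : R) : C := (tau - RtoC z ^ 2)%C.

Let D0 : derives W W1 := Csmooth_derives W 0 (proj1 Hsol).
Let D1 : derives W1 W2 := Csmooth_derives W 1 (proj1 Hsol).
Let D2 : derives W2 W3 := Csmooth_derives W 2 (proj1 Hsol).
Let D3 : derives W3 (CDerive_n W 4) := Csmooth_derives W 3 (proj1 Hsol).

Lemma shear_neq_0 (z : R) : a z <> 0%C.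
Proof.
  intros E. apply (f_equal snd) in E. cbn in E. unfold Im in Htau. lra.
Qed.

(** The equation multiplied by [- Ci]. The factor [a] stays on the left, so later eliminations of
    [W'''] are polynomial. *)
Lemma third_derivative_eq (z : R) :
  (a z * W3 z = 6 * RtoC z * W2 z + 6 * W1 z + Ci * a z * a z * W1 z)%C.
Proof.
  pose proof (proj1 (proj2 Hsol) z) as E. cbv beta in E.
  rewrite (CDerive_3_shear_mult tau W W1 W2 W3 D0 D1 D2) in E.
  change (CDerive W z) with (W1 z) in E. change (tau - RtoC z ^ 2)%C with (a z) in E.
  set (X := (a z * W3 z - 6 * RtoC z * W2 z - 6 * W1 z)%C) in *.
  assert (EX : X = (Ci * a z * a z * W1 z)%C).
  { transitivity (- (Ci * Ci) * X)%C; [rewrite Ci_sqr; ring|].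
    transitivity (Ci * a z * a z * W1 z - Ci * (a z ^ 2 * W1 z + Ci * X))%C; [ring|].
    rewrite E. ring. }
  rewrite <- EX. unfold X. ring.
Qed.

(* [omega (a W)''' + z (a W)'' - (a W)'], with [W'''] eliminated by the equation. *)
Let ladder (z : R) : C :=
  (RtoC z * a z * W2 z + (Ci * omega * a z * a z - a z - 4 * RtoC z ^ 2) * W1 z)%C.
(** The derivative of [ladder] with [W'''] again eliminated. It has the factor [Ci * a], so its
    vanishing is a first order equation for [W']. *)
Let ladder1 (z : R) : C :=
  (Ci * omega * a z * a z * W2 z
   + Ci * RtoC z * (a z * a z - 4 * omega * a z) * W1 z)%C.

Lemma derives_ladder : derives ladder ladder1.
Proof.
  pose proof (derives_shear tau) as Da. fold a in Da.
  refine (derives_ext _ _ _ _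
    (derives_plus _ _ _ _
      (derives_mult _ _ _ _ (derives_mult _ _ _ _ derives_id Da) D2)
      (derives_mult _ _ _ _
        (derives_minus _ _ _ _
          (derives_minus _ _ _ _
            (derives_cmul (Ci * omega)%C _ _ (derives_mult _ _ _ _ Da Da)) Da)
          (derives_cmul 4%C _ _ (derives_mult _ _ _ _ derives_id derives_id))) D1)) _ _).
  - intros z. unfold ladder. ring.
  - intros z. cbn beta. unfold ladder1.
    transitivity (RtoC z * (a z * W3 z) +
      ((1 * a z + RtoC z * - (2 * RtoC z)) * W2 z +
       ((Ci * omega * (- (2 * RtoC z) * a z + a z * - (2 * RtoC z)) - - (2 * RtoC z)
         - 4 * (1 * RtoC z + RtoC z * 1)) * W1 z
        + (Ci * omega * (a z * a z) - a z - 4 * (RtoC z * RtoC z)) * W2 z)))%C; [ring|].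
    rewrite third_derivative_eq. ring.
Qed.

(** The intertwining relation: [F] solves a second order equation with no first order term, whose
    coefficient has constant real part. *)
Lemma derives_ladder1 : derives ladder1 (fun z => Ci * (a z - 2 * omega) * ladder z)%C.
Proof.
  pose proof (derives_shear tau) as Da. fold a in Da.
  refine (derives_ext _ _ _ _
    (derives_plus _ _ _ _
      (derives_mult _ _ _ _ (derives_cmul (Ci * omega)%C _ _ (derives_mult _ _ _ _ Da Da)) D2)
      (derives_mult _ _ _ _
        (derives_mult _ _ _ _ (derives_cmul Ci _ _ derives_id)
          (derives_minus _ _ _ _ (derives_mult _ _ _ _ Da Da)
             (derives_cmul (4 * omega)%C _ _ Da))) D1)) _ _).
  - intros z. unfold ladder1. ring.
  - intros z. cbn beta. unfold ladder.
    match goal with |- ?L = ?Rh =>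
      transitivity (L - Ci * omega * a z * (a z * W3 z)
        + Ci * omega * a z * (6 * RtoC z * W2 z + 6 * W1 z + Ci * a z * a z * W1 z))%C
    end.
    { rewrite <- third_derivative_eq. ring. }
    (* With [Ci] written as [omega ^ 2], the claim is a polynomial identity modulo
       [omega ^ 4 = - 1]. *)
    rewrite <- omega_sqr.
    assert (O4 : (omega * omega * omega * omega = - (1))%C)
      by (rewrite <- Ci_sqr, <- omega_sqr; ring).
    ring [O4].
Qed.

Lemma W_bounded : exists M, forall z, Cmod (W z) <= M.
Proof.
  pose proof (proj2 (proj2 Hsol)) as [L1 L2].
  apply (filterlim_C_pair m_infty) in L1. apply (filterlim_C_pair p_infty) in L2.
  assert (Cn : forall g dg : R -> R, (forall t, is_derive g t (dg t)) ->
                 forall x, continuity_pt g x).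
  { intros g dg Hg x.
    apply continuity_pt_filterlim, (ex_derive_continuous (V := R_NormedModule)).
    eexists; apply Hg. }
  destruct (bounded_of_limits _ _ _ (Cn _ _ (derives_Re _ _ D0)) (proj1 L1) (proj1 L2))
    as [M1 B1].
  destruct (bounded_of_limits _ _ _ (Cn _ _ (derives_Im _ _ D0)) (proj2 L1) (proj2 L2))
    as [M2 B2].
  exists (M1 + M2). intros z. eapply Rle_trans; [apply Cmod_le_Re_Im|].
  apply Rplus_le_compat; auto.
Qed.

Lemma Cmod_shear_ge (z : R) : - Im tau <= Cmod (a z).
Proof.
  pose proof (im_le_Cmod (a z)) as B. apply Rabs_le_between in B.
  unfold a in B at 2. unfold Im in *. cbn in B. lra.
Qed.

Lemma Cmod_shear_le (z : R) : Cmod (a z) <= Cmod tau + z ^ 2.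
Proof.
  unfold a, Cminus. eapply Rle_trans; [apply Cmod_triangle|].
  rewrite Cmod_opp, <- RtoC_pow, Cmod_R, Rabs_pos_eq by nra. lra.
Qed.

(** Dividing the equation by [a], whose modulus is at least [- Im tau], bounds [W3] by [W1] and [W2]
    with a factor of order [(1 + x ^ 2) ^ 2] on [[x, x + 1]]; [third_order_bound] squares this
    factor. *)
Lemma W_derivatives_bound : exists A, forall x,
  Cmod (W1 x) <= A * (1 + x ^ 2) ^ 4 /\ Cmod (W2 x) <= A * (1 + x ^ 2) ^ 4.
Proof.
  destruct W_bounded as [M HM].
  set (T := Cmod tau). set (d := - Im tau).
  assert (HT : 0 <= T) by apply Cmod_ge_0.
  assert (Hd : 0 < d) by (unfold d; lra).
  (* The 24 absorbs [6 * Rabs t <= 18 * q] and the constant 6, [(T + 2) ^ 2] absorbs the square of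
     the modulus of [a], and the leading 1 ensures [B >= 1]. *)
  set (B := 1 + (24 + (T + 2) ^ 2) / d).
  assert (HB : 1 <= B).
  { unfold B. assert (0 < (24 + (T + 2) ^ 2) / d) by (apply Rdiv_lt_0_compat; nra). lra. }
  exists (30000 * B ^ 2 * M). intros x.
  replace (30000 * B ^ 2 * M * (1 + x ^ 2) ^ 4)
    with (30000 * (B * (1 + x ^ 2) ^ 2) ^ 2 * M) by ring.
  set (q := 1 + x ^ 2).
  assert (Hq : 1 <= q) by (unfold q; nra).
  apply (third_order_bound W W1 W2 W3 (CDerive_n W 4)); auto.
  - nra.
  - intros t Ht.
    (* Follows from [t ^ 2 + (t - 2 * x) ^ 2 = 2 * x ^ 2 + 2 * (t - x) ^ 2]. *)
    assert (Hzq : t ^ 2 <= 2 * q).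
    { unfold q. assert ((t - x) ^ 2 <= 1) by nra.
      pose proof (pow2_ge_0 (t - 2 * x)). nra. }
    assert (Hz : Rabs t <= 3 * q).
    { apply Rabs_le. split; nra. }
    pose proof (Cmod_shear_le t) as Ha. fold T in Ha.
    pose proof (Cmod_shear_ge t) as Ha'. fold d in Ha'.
    assert (E : Cmod (a t) * Cmod (W3 t) <=
       6 * Rabs t * Cmod (W2 t) + (6 + Cmod (a t) ^ 2) * Cmod (W1 t)).
    { rewrite <- Cmod_mult, third_derivative_eq.
      eapply Rle_trans; [apply Cmod_triangle|].
      eapply Rle_trans; [apply Rplus_le_compat_r, Cmod_triangle|].
      rewrite !Cmod_mult, Cmod_Ci, !Cmod_R, (Rabs_pos_eq 6) by lra. lra. }
    assert (Haq : Cmod (a t) <= (T + 2) * q) by nra.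
    assert (Hsq : Cmod (a t) ^ 2 <= (T + 2) ^ 2 * q ^ 2).
    { rewrite <- Rpow_mult_distr. apply pow_incr. lra. }
    set (u := Cmod (a t)) in *.
    pose proof (Cmod_ge_0 (W1 t)). pose proof (Cmod_ge_0 (W2 t)).
    pose proof (Cmod_ge_0 (W3 t)).
    set (w1 := Cmod (W1 t)) in *. set (w2 := Cmod (W2 t)) in *.
    set (w3 := Cmod (W3 t)) in *.
    assert (Hq2 : q <= q ^ 2) by nra.
    set (S := (24 + (T + 2) ^ 2) * q ^ 2).
    assert (HS : 0 <= (T + 2) ^ 2 * q ^ 2) by nra.
    assert (S1 : 6 * Rabs t <= S) by (unfold S; lra).
    assert (S2 : 6 + u ^ 2 <= S) by (unfold S; lra).
    assert (E' : d * w3 <= S * (w2 + w1)).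
    { apply Rle_trans with (u * w3); [apply Rmult_le_compat_r; lra|].
      eapply Rle_trans; [exact E|].
      assert (6 * Rabs t * w2 <= S * w2) by (apply Rmult_le_compat_r; lra).
      assert ((6 + u ^ 2) * w1 <= S * w1) by (apply Rmult_le_compat_r; lra).
      lra. }
    assert (EB : d * (B * q ^ 2) = d * q ^ 2 + S) by (unfold B, S; field; lra).
    apply Rmult_le_reg_l with d; [lra|].
    rewrite <- Rmult_assoc, EB.
    assert (0 <= d * q ^ 2 * (w2 + w1)).
    { apply Rmult_le_pos; [|lra]. apply Rmult_le_pos; [lra | apply pow_le; lra]. }
    lra.
Qed.

(** The coefficients of [W1] and [W2] grow at most like [(1 + x ^ 2) ^ 2], which raises the exponent
    from 4 to 6. *)
Lemma ladder_bound : exists A, forall x, Cmod (ladder x) <= A * (1 + x ^ 2) ^ 6.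
Proof.
  destruct W_derivatives_bound as [A HA].
  set (T := Cmod tau).
  assert (HT : 0 <= T) by apply Cmod_ge_0.
  exists (((T + 1) + (T + 1) ^ 2 + (T + 1) + 4) * A). intros x.
  destruct (HA x) as [H1 H2].
  assert (E : Cmod (ladder x) <= Rabs x * Cmod (a x) * Cmod (W2 x)
     + (Cmod (a x) ^ 2 + Cmod (a x) + 4 * x ^ 2) * Cmod (W1 x)).
  { unfold ladder. eapply Rle_trans; [apply Cmod_triangle|].
    rewrite !Cmod_mult, Cmod_R.
    apply Rplus_le_compat_l, Rmult_le_compat_r; [apply Cmod_ge_0|].
    unfold Cminus. eapply Rle_trans; [apply Cmod_triangle|].
    eapply Rle_trans; [apply Rplus_le_compat_r, Cmod_triangle|].
    rewrite !Cmod_opp, !Cmod_mult, Cmod_Ci, Cmod_omega, <- RtoC_pow, !Cmod_R,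
      (Rabs_pos_eq 4), (Rabs_pos_eq (x ^ 2)) by nra. lra. }
  pose proof (Cmod_shear_le x) as Ha. fold T in Ha.
  pose proof (Cmod_ge_0 (a x)) as Ha0.
  pose proof (Cmod_ge_0 (W1 x)). pose proof (Cmod_ge_0 (W2 x)).
  assert (Hx : Rabs x <= 1 + x ^ 2) by (apply Rabs_le; split; nra).
  pose proof (Rabs_pos x).
  set (q := 1 + x ^ 2) in *.
  assert (Hxq : x ^ 2 <= q) by (unfold q; lra).
  assert (Hq : 1 <= q) by (unfold q; nra).
  set (u := Cmod (a x)) in *.
  assert (Hu : u <= (T + 1) * q) by (unfold q in *; nra).
  assert (Hq2 : q <= q ^ 2) by nra.
  assert (P0 : 0 <= A * q ^ 4) by lra.
  assert (C1 : Rabs x * u <= (T + 1) * q ^ 2) by nra.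
  assert (C2 : u ^ 2 <= (T + 1) ^ 2 * q ^ 2)
    by (rewrite <- Rpow_mult_distr; apply pow_incr; lra).
  assert (C3 : u <= (T + 1) * q ^ 2) by nra.
  assert (Q1 : Rabs x * u * Cmod (W2 x) <= (T + 1) * q ^ 2 * (A * q ^ 4)).
  { apply Rmult_le_compat; nra. }
  assert (Q2 : (u ^ 2 + u + 4 * x ^ 2) * Cmod (W1 x) <=
               ((T + 1) ^ 2 * q ^ 2 + (T + 1) * q ^ 2 + 4 * q ^ 2) * (A * q ^ 4)).
  { apply Rmult_le_compat; nra. }
  replace (((T + 1) + (T + 1) ^ 2 + (T + 1) + 4) * A * q ^ 6)
    with ((T + 1) * q ^ 2 * (A * q ^ 4)
      + ((T + 1) ^ 2 * q ^ 2 + (T + 1) * q ^ 2 + 4 * q ^ 2) * (A * q ^ 4)) by ring.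
  lra.
Qed.

Lemma ladder_zero (z : R) : ladder z = 0%C.
Proof.
  (* The real part of [Ci * (a z - 2 * omega)], the same for all [z] because [z ^ 2] is real. Hence
     the second derivative of the squared modulus of [F] is at least [2 * kappa] times that
     square. *)
  set (kappa := / sqrt 2 * 2 - Im tau).
  assert (Hk : 0 < kappa) by (unfold kappa; pose proof inv_sqrt2_pos; lra).
  destruct ladder_bound as [A HA].
  pose proof (derives_Re _ _ derives_ladder) as R0. pose proof (derives_Im _ _ derives_ladder) as I0.
  pose proof (derives_Re _ _ derives_ladder1) as R1. pose proof (derives_Im _ _ derives_ladder1) as I1.
  set (F2 := fun z => (Ci * (a z - 2 * omega) * ladder z)%C) in R1, I1.
  set (u := fun z => Re (ladder z)) in *. set (v := fun z => Im (ladder z)) in *.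
  set (u1 := fun z => Re (ladder1 z)) in *. set (v1 := fun z => Im (ladder1 z)) in *.
  set (u2 := fun z => Re (F2 z)) in *. set (v2 := fun z => Im (F2 z)) in *.
  change (forall x, is_derive u x (u1 x)) in R0.
  change (forall x, is_derive v x (v1 x)) in I0.
  change (forall x, is_derive u1 x (u2 x)) in R1.
  change (forall x, is_derive v1 x (v2 x)) in I1.
  assert (N0 : forall x, u x ^ 2 + v x ^ 2 = 0).
  { apply (convex_poly_zero _ (fun x => 2 * (u x * u1 x + v x * v1 x))
      (fun x => 2 * (u1 x ^ 2 + v1 x ^ 2 + u x * u2 x + v x * v2 x))
      (sqrt (2 * kappa)) (A ^ 2) 12).
    - apply sqrt_lt_R0; lra.
    - intros x. auto_derive; [repeat split; eexists; eauto|]. derive_values. ring.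
    - intros x. auto_derive; [repeat split; eexists; eauto|]. derive_values. ring.
    - intros x. nra.
    - intros x. rewrite <- Rsqr_pow2, Rsqr_sqrt by lra.
      assert (E : u x * u2 x + v x * v2 x = kappa * (u x ^ 2 + v x ^ 2)).
      { unfold u, v, u2, v2, F2, kappa, a, omega. destruct (ladder x) as [p q].
        unfold Re, Im. cbn. ring. }
      nra.
    - intros x. replace (u x ^ 2 + v x ^ 2) with (Cmod (ladder x) ^ 2) by apply Cmod2_alt.
      replace (A ^ 2 * (1 + x ^ 2) ^ 12) with ((A * (1 + x ^ 2) ^ 6) ^ 2) by ring.
      apply pow_incr. split; [apply Cmod_ge_0 | apply HA]. }
  specialize (N0 z).
  assert (u z = 0) by nra. assert (v z = 0) by nra.
  apply injective_projections; assumption.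
Qed.

Lemma ladder1_zero (z : R) : ladder1 z = 0%C.
Proof.
  rewrite <- (derives_CDerive _ _ derives_ladder).
  rewrite (CDerive_ext _ (fun _ => 0%C) z ladder_zero).
  apply (derives_CDerive _ _ (derives_const 0%C)).
Qed.

Lemma first_order_eq (z : R) :
  (omega * a z * W2 z = - RtoC z * (a z - 4 * omega) * W1 z)%C.
Proof.
  assert (E : (Ci * a z * (omega * a z * W2 z + RtoC z * (a z - 4 * omega) * W1 z) = 0)%C).
  { rewrite <- (ladder1_zero z). unfold ladder1. ring. }
  apply Cmult_integral in E. destruct E as [E | E].
  - exfalso. apply Cmult_integral in E. destruct E as [E | E].
    + apply (f_equal snd) in E. cbn in E. lra.
    + exact (shear_neq_0 z E).
  - transitivity (omega * a z * W2 z + RtoC z * (a z - 4 * omega) * W1 z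
      - RtoC z * (a z - 4 * omega) * W1 z)%C; [ring|]. rewrite E. ring.
Qed.

(** Eliminates [W''] between [F = 0] and [F' = 0]: the combination [- omega * a * F] becomes
    [a ^ 2 * (a + z ^ 2 + omega) * W'], and [a + z ^ 2 = tau]. *)
Lemma tau_or_trivial (z : R) : ((tau + omega) * W1 z = 0)%C.
Proof.
  pose proof (ladder_zero z) as E.
  assert (E2 : (a z * a z * ((tau + omega) * W1 z) = 0)%C).
  { transitivity (- omega * a z * ladder z)%C; [|rewrite E; ring].
    transitivity (- RtoC z * a z * (- RtoC z * (a z - 4 * omega) * W1 z)
      - omega * a z * (Ci * omega * a z * a z - a z - 4 * RtoC z ^ 2) * W1 z)%C.
    - replace tau with (a z + RtoC z ^ 2)%C by (unfold a; ring).
      assert (O4 : (omega * omega * omega * omega = - (1))%C)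
        by (rewrite <- Ci_sqr, <- omega_sqr; ring).
      rewrite <- omega_sqr. ring [O4].
    - rewrite <- first_order_eq. unfold ladder. ring. }
  apply Cmult_integral in E2. destruct E2 as [E2 | E2]; [exfalso | exact E2].
  apply Cmult_integral in E2. destruct E2; eapply shear_neq_0; eassumption.
Qed.

(** Otherwise [W'] vanishes identically, and a constant cannot have the limits 0 and 1. *)
Lemma tau_unique : tau = (- omega)%C.
Proof.
  destruct (Ceq_dec (tau + omega) 0) as [E | NE].
  - replace tau with (tau + omega - omega)%C by ring. rewrite E. ring.
  - exfalso.
    assert (E : forall z, W1 z = 0%C).
    { intros z. destruct (Cmult_integral _ _ (tau_or_trivial z)); [contradiction | assumption]. }
    assert (K : forall x, W x = W 0).
    { intros x. apply derives_zero_const.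
      exact (derives_ext _ _ _ _ D0 (fun _ => eq_refl) E). }
    pose proof (proj2 (proj2 Hsol)) as [L1 L2].
    apply (filterlim_C_pair m_infty) in L1. apply (filterlim_C_pair p_infty) in L2.
    destruct L1 as [L1 _], L2 as [L2 _].
    apply (is_lim_ext _ (fun _ => Re (W 0))) in L1; [|intros; now rewrite K].
    apply (is_lim_ext _ (fun _ => Re (W 0))) in L2; [|intros; now rewrite K].
    apply is_lim_unique in L1, L2. rewrite Lim_const in L1, L2.
    rewrite L1 in L2. cbn in L2. injection L2. lra.
Qed.
End Solution.

(** * The explicit solution *)

(** A chain of existential derivatives in place of the iterates [CDerive_n]: closure under products,
    inverses and exponentials then follows by induction on the order, without formulas for higher
    derivatives. *)
Fixpoint derives_n (n : nat) (f : R -> C) : Prop :=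
  match n with
  | O => True
  | S m => exists df, derives f df /\ derives_n m df
  end.

Lemma derives_n_pred (n : nat) (f : R -> C) : derives_n (S n) f -> derives_n n f.
Proof.
  revert f. induction n as [|n IH]; intros f [df [D H]]; [exact I|].
  exists df. split; [exact D|]. apply IH, H.
Qed.

Lemma derives_n_const (c : C) (n : nat) : derives_n n (fun _ => c).
Proof.
  revert c. induction n as [|n IH]; intros c; [exact I|].
  eexists. split; [apply derives_const | apply IH].
Qed.

Lemma derives_n_id (n : nat) : derives_n n RtoC.
Proof.
  destruct n as [|n]; [exact I|].
  eexists. split; [apply derives_id | apply derives_n_const].
Qed.

Lemma derives_n_plus (n : nat) (f g : R -> C) :
  derives_n n f -> derives_n n g -> derives_n n (fun x => f x + g x)%C.
Proof.
  revert f g. induction n as [|n IH]; intros f g Hf Hg; [exact I|].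
  destruct Hf as [df [Df Hf]], Hg as [dg [Dg Hg]].
  eexists. split; [apply (derives_plus _ _ _ _ Df Dg) | apply IH; assumption].
Qed.

Lemma derives_n_mult (n : nat) (f g : R -> C) :
  derives_n n f -> derives_n n g -> derives_n n (fun x => f x * g x)%C.
Proof.
  revert f g. induction n as [|n IH]; intros f g Hf Hg; [exact I|].
  pose proof (derives_n_pred _ _ Hf) as Hf'. pose proof (derives_n_pred _ _ Hg) as Hg'.
  destruct Hf as [df [Df Hf]], Hg as [dg [Dg Hg]].
  eexists. split; [apply (derives_mult _ _ _ _ Df Dg)|].
  apply derives_n_plus; apply IH; assumption.
Qed.

(** The derivative of [/ f] contains [/ f] again, but needs it only to one order less. *)
Lemma derives_n_inv (n : nat) (f : R -> C) :
  (forall x, f x <> 0%C) -> derives_n n f -> derives_n n (fun x => / f x)%C.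
Proof.
  intros Hn. induction n as [|n IH]; intros Hf; [exact I|].
  pose proof (IH (derives_n_pred _ _ Hf)) as Hi.
  destruct Hf as [df [Df Hf]].
  exists (fun x => (RtoC (-1) * df x) * / f x * / f x)%C. split.
  - refine (derives_ext _ _ _ _ (derives_inv _ _ Df Hn) (fun _ => eq_refl) _).
    intros x. f_equal. f_equal. apply injective_projections; cbn; ring.
  - repeat apply derives_n_mult; auto using derives_n_const.
Qed.

Lemma derives_n_exp (n : nat) (f : R -> C) :
  derives_n n f -> derives_n n (fun x => Cexp (f x)).
Proof.
  induction n as [|n IH]; intros Hf; [exact I|].
  pose proof (IH (derives_n_pred _ _ Hf)) as Hi.
  destruct Hf as [df [Df Hf]].
  eexists. split; [apply (derives_exp _ _ Df)|].
  apply derives_n_mult; assumption.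
Qed.

Lemma CDerive_n_ext (n : nat) (f g : R -> C) :
  (forall t, f t = g t) -> forall t, CDerive_n f n t = CDerive_n g n t.
Proof.
  intros H. induction n as [|n IH]; [exact H|].
  intros t. apply CDerive_ext, IH.
Qed.

Lemma CDerive_n_S (n : nat) (f : R -> C) : CDerive_n f (S n) = CDerive_n (CDerive f) n.
Proof. induction n as [|n IH]; [reflexivity|]. cbn in *. now rewrite IH. Qed.

(** The chain exposes the first derivative whereas [CDerive_n] adds the last one; [CDerive_n_S]
    moves between the two orders. *)
Lemma derives_n_Csmooth (f : R -> C) : (forall n, derives_n n f) -> Csmooth f.
Proof.
  intros H n. specialize (H (S n)). revert f H.
  induction n as [|n IH]; intros f [df [D Hd]] x.
  - exists (df x). apply D.
  - rewrite CDerive_n_S.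
    apply (ex_derive_ext (V := C_R_NormedModule) (CDerive_n df n)).
    + intros t. symmetry. apply CDerive_n_ext, derives_CDerive, D.
    + apply IH, Hd.
Qed.

Lemma filterlim_infinities (f : R -> C) (l1 l2 : C) (A : R) :
  (forall z, 1 <= z -> Cmod (f (- z) - l1) <= A / z) ->
  (forall z, 1 <= z -> Cmod (f z - l2) <= A / z) ->
  filterlim f (Rbar_locally m_infty) (locally (T := C_UniformSpace) l1) /\
  filterlim f (Rbar_locally p_infty) (locally (T := C_UniformSpace) l2).
Proof.
  intros H1 H2.
  assert (B : forall (l w : C) z (e : posreal),
    Rmax 1 (A / e) < z -> Cmod (w - l) <= A / z -> ball (M := C_UniformSpace) l e w).
  { intros l w z e Hz Hw.
    assert (Hz1 : 1 < z) by (eapply Rle_lt_trans; [apply Rmax_l | exact Hz]).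
    assert (Hz2 : A / e < z) by (eapply Rle_lt_trans; [apply Rmax_r | exact Hz]).
    pose proof (cond_pos e) as He.
    assert (Hw' : Cmod (w - l) < e).
    { eapply Rle_lt_trans; [exact Hw|].
      apply Rmult_lt_reg_r with z; [lra|].
      apply Rmult_lt_compat_r with (r := e) in Hz2; [|lra].
      unfold Rdiv in *. rewrite Rmult_assoc, Rinv_l in * by lra. lra. }
    split.
    - exact (Rle_lt_trans _ _ _ (re_le_Cmod (w - l)) Hw').
    - exact (Rle_lt_trans _ _ _ (im_le_Cmod (w - l)) Hw'). }
  split; apply filterlim_locally; intros e.
  - exists (- Rmax 1 (A / e)). intros z Hz.
    apply (B l1 (f z) (- z) e); [lra|].
    rewrite <- (Ropp_involutive z) at 1. apply H1.
    pose proof (Rmax_l 1 (A / e)). lra.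
  - exists (Rmax 1 (A / e)). intros z Hz.
    apply (B l2 (f z) z e); [lra|]. apply H2.
    pose proof (Rmax_l 1 (A / e)). lra.
Qed.

(** * The closed form: derivatives, equation, limits and uniqueness *)

Definition rot : C := Cexp (- (Ci * (PI / 8)%R)).
(** Conjugate and inverse of [omega]; as [eta = rot * z] and [rot ^ 2 = omega_bar], it is the
    coefficient in [eta ^ 2 = omega_bar * z ^ 2]. *)
Definition omega_bar : C := (/ sqrt 2, - / sqrt 2).

Lemma cos_sin_PI4 : cos (PI / 4) = / sqrt 2 /\ sin (PI / 4) = / sqrt 2.
Proof. rewrite cos_PI4, sin_PI4. unfold Rdiv. rewrite !Rmult_1_l. auto. Qed.

Lemma rot_sqr : (rot * rot)%C = omega_bar.
Proof.
  unfold rot. rewrite <- Cexp_plus.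
  replace (- (Ci * (PI / 8)%R) + - (Ci * (PI / 8)%R))%C with ((0, - (PI / 4)) : C)
    by (apply injective_projections; cbn; field).
  unfold Cexp, Re, Im. cbn [fst snd]. rewrite exp_0, cos_neg, sin_neg.
  destruct cos_sin_PI4 as [-> ->].
  apply injective_projections; cbn; ring.
Qed.

Lemma omega_omega_bar : (omega * omega_bar)%C = 1%C.
Proof. pose proof inv_sqrt2_sqr. apply injective_projections; cbn; lra. Qed.

Lemma Cmod_rot : Cmod rot = 1.
Proof. unfold rot. rewrite Cmod_Cexp. rewrite <- exp_0. f_equal. cbn. ring. Qed.

Definition profile (z : R) : C :=
  (RtoC (1 / 2) *
   (1 + Cerf (eta z / RtoC (sqrt 2))
    + RtoC (sqrt (2 / PI)) * (eta z / (1 + eta z ^ 2)) * Cexp (- (eta z ^ 2 / 2))))%C.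

Lemma RtoC_sqrt2_neq_0 : RtoC (sqrt 2) <> 0%C.
Proof.
  intros E. apply (f_equal fst) in E. cbn in E.
  assert (0 < sqrt 2) by (apply sqrt_lt_R0; lra). lra.
Qed.

Lemma Cexp_neq_0 (z : C) : Cexp z <> 0%C.
Proof.
  intros E. apply (f_equal Cmod) in E. rewrite Cmod_Cexp, Cmod_0 in E.
  pose proof (exp_pos (Re z)). lra.
Qed.

Section Profile.

(** In terms of [eta]: [den] is [1 + eta ^ 2], [gau] is [exp (- eta ^ 2 / 2)], [kap * z] is the
    argument of [Cerf], and [amp * z] is [sqrt (2 / PI) * eta]. *)
Let den (z : R) : C := (1 + omega_bar * RtoC z ^ 2)%C.
Let gau (z : R) : C := Cexp (- omega_bar / 2 * RtoC z ^ 2)%C.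
Let kap : C := (rot / RtoC (sqrt 2))%C.
Let amp : C := (RtoC (sqrt (2 / PI)) * rot)%C.

Lemma kap_sqr : (kap * kap)%C = (omega_bar / 2)%C.
Proof.
  unfold kap. rewrite <- rot_sqr.
  assert (E : (RtoC (sqrt 2) * RtoC (sqrt 2))%C = 2%C)
    by (rewrite <- RtoC_mult, sqrt_sqrt by lra; reflexivity).
  pose proof RtoC_sqrt2_neq_0 as N. rewrite <- E. field. exact N.
Qed.

Lemma den_neq_0 (z : R) : den z <> 0%C.
Proof.
  intros E. apply (f_equal fst) in E. unfold den, omega_bar in E. cbn in E.
  pose proof inv_sqrt2_pos. nra.
Qed.

Lemma amp_neq_0 : amp <> 0%C.
Proof.
  unfold amp. apply Cmult_neq_0; [|apply Cexp_neq_0].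
  intros E. apply (f_equal fst) in E. cbn in E. pose proof PI_RGT_0.
  assert (0 < sqrt (2 / PI)); [|lra].
  apply sqrt_lt_R0, Rdiv_lt_0_compat; lra.
Qed.

Lemma erf_constant : 2 / sqrt PI * / sqrt 2 = sqrt (2 / PI).
Proof.
  pose proof PI_RGT_0.
  assert (0 < sqrt 2) by (apply sqrt_lt_R0; lra).
  assert (0 < sqrt PI) by (apply sqrt_lt_R0; lra).
  rewrite sqrt_div by lra.
  rewrite <- (sqrt_sqrt 2) at 1 by lra. field. lra.
Qed.

Lemma erf_constant_kap : (RtoC (2 / sqrt PI) * kap = amp)%C.
Proof.
  unfold kap, amp. rewrite <- erf_constant, RtoC_mult, RtoC_inv.
  - unfold Cdiv. ring.
  - apply Rgt_not_eq, sqrt_lt_R0. lra.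
Qed.

Lemma eta_sqr (z : R) : (eta z ^ 2)%C = (omega_bar * RtoC z ^ 2)%C.
Proof. unfold eta. fold rot. rewrite <- rot_sqr. ring. Qed.

Lemma profile_eq (z : R) :
  profile z = (RtoC (1 / 2) * (1 + RtoC (2 / sqrt PI) * gauss_int kap z
                               + amp * RtoC z * / den z * gau z))%C.
Proof.
  unfold profile.
  replace (eta z / RtoC (sqrt 2))%C with (kap * RtoC z)%C
    by (unfold eta, kap; fold rot; unfold Cdiv; ring).
  rewrite Cerf_gauss_int, eta_sqr. fold (den z).
  replace (- (omega_bar * RtoC z ^ 2 / 2))%C with (- omega_bar / 2 * RtoC z ^ 2)%C
    by (unfold Cdiv; ring).
  fold (gau z). unfold amp, eta, Cdiv. fold rot. ring.
Qed.

Lemma derives_den : derives den (fun z => 2 * omega_bar * RtoC z)%C.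
Proof.
  refine (derives_ext _ _ _ _ (derives_plus _ _ _ _ (derives_const 1%C)
    (derives_cmul omega_bar _ _ (derives_mult _ _ _ _ derives_id derives_id))) _ _).
  - intros x. unfold den. ring.
  - intros x. ring.
Qed.

Lemma derives_gau : derives gau (fun z => - omega_bar * RtoC z * gau z)%C.
Proof.
  refine (derives_ext _ _ _ _ (derives_gaussian (- omega_bar / 2)) _ _).
  - reflexivity.
  - intros x. fold (gau x). field.
Qed.

(** The error function and the rational Gaussian term differentiate to a single product, which has
    no zeros; uniqueness divides by it. *)
Let dprofile (z : R) : C := (amp * gau z * / den z * / den z)%C.

Lemma derives_profile : derives profile dprofile.
Proof.
  refine (derives_ext _ _ _ _
    (derives_cmul (RtoC (1 / 2)) _ _
      (derives_plus _ _ _ _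
        (derives_plus _ _ _ _ (derives_const 1%C)
           (derives_cmul (RtoC (2 / sqrt PI)) _ _ (derives_gauss_int kap)))
        (derives_mult _ _ _ _
          (derives_mult _ _ _ _ (derives_cmul amp _ _ derives_id)
             (derives_inv _ _ derives_den den_neq_0))
          derives_gau))) _ _).
  - intros z. symmetry. apply profile_eq.
  - intros z. cbn beta.
    replace (- (kap * RtoC z) ^ 2)%C with (- omega_bar / 2 * RtoC z ^ 2)%C.
    2: { transitivity (- (kap * kap) * RtoC z ^ 2)%C; [rewrite kap_sqr; unfold Cdiv |]; ring. }
    fold (gau z).
    replace (RtoC (2 / sqrt PI) * (kap * gau z))%C with (amp * gau z)%C
      by (rewrite <- erf_constant_kap; ring).
    rewrite RtoC_div by lra. unfold dprofile.
    assert (Ez : (omega_bar * RtoC z ^ 2 = den z - 1)%C) by (unfold den; ring).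
    transitivity (1 / 2 * amp * gau z * (1 + / den z
      - (2 * / den z * / den z + / den z) * (omega_bar * RtoC z ^ 2)))%C; [ring|].
    rewrite Ez. field. apply den_neq_0.
Qed.

Lemma dprofile_neq_0 (z : R) : dprofile z <> 0%C.
Proof.
  assert (I : (/ den z)%C <> 0%C).
  { intros E. pose proof (Cinv_r _ (den_neq_0 z)) as R. rewrite E, Cmult_0_r in R.
    apply (f_equal fst) in R. cbn in R. lra. }
  apply Cmult_neq_0; [|exact I]. apply Cmult_neq_0; [|exact I].
  apply Cmult_neq_0; [exact amp_neq_0 | apply Cexp_neq_0].
Qed.

(** The logarithmic derivative of [dprofile]: [- omega_bar * z] from the Gaussian and
    [- 4 * omega_bar * z / den] from the two inverse factors. *)
Let logd (z : R) : C := (- (omega_bar * RtoC z) * (1 + 4 * / den z))%C.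

Lemma derives_dprofile : derives dprofile (fun z => logd z * dprofile z)%C.
Proof.
  refine (derives_ext _ _ _ _
    (derives_mult _ _ _ _
      (derives_mult _ _ _ _ (derives_cmul amp _ _ derives_gau)
        (derives_inv _ _ derives_den den_neq_0))
      (derives_inv _ _ derives_den den_neq_0)) _ _).
  - reflexivity.
  - intros z. cbn beta. unfold dprofile, logd. ring.
Qed.

Lemma derives_dprofile1 :
  derives (fun z => logd z * dprofile z)%C
    (fun z => ((- omega_bar * (1 + 4 * / den z)
       + 8 * (omega_bar * RtoC z) * (omega_bar * RtoC z) * / den z * / den z)
       + logd z * logd z) * dprofile z)%C.
Proof.
  refine (derives_ext _ _ _ _
    (derives_mult _ _ _ _
      (derives_mult _ _ _ _ (derives_cmul (- omega_bar)%C _ _ derives_id)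
         (derives_plus _ _ _ _ (derives_const 1%C)
            (derives_cmul 4%C _ _ (derives_inv _ _ derives_den den_neq_0))))
      derives_dprofile) _ _).
  - intros z. cbn beta. unfold logd. ring.
  - intros z. cbn beta. unfold logd. ring.
Qed.

Lemma profile_smooth : Csmooth profile.
Proof.
  apply derives_n_Csmooth. intros n. apply derives_n_pred.
  exists dprofile. split; [exact derives_profile|].
  assert (Hsq : forall d : C, derives_n n (fun z => d * RtoC z ^ 2)%C).
  { intros d. unfold Cpow.
    repeat apply derives_n_mult; auto using derives_n_const, derives_n_id. }
  assert (Hb : derives_n n (fun z => / den z)%C).
  { apply derives_n_inv; [exact den_neq_0|].
    apply derives_n_plus; [apply derives_n_const | apply Hsq]. }
  unfold dprofile. repeat apply derives_n_mult; auto using derives_n_const.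
  apply derives_n_exp, Hsq.
Qed.

Lemma profile_equation (z : R) :
  ((- omega - RtoC z ^ 2) ^ 2 * CDerive profile z
   + Ci * CDerive_n (fun y : R => (- omega - RtoC y ^ 2) * profile y) 3 z)%C = 0%C.
Proof.
  rewrite (CDerive_3_shear_mult _ _ _ _ _ derives_profile derives_dprofile derives_dprofile1).
  rewrite (derives_CDerive _ _ derives_profile).
  (* As [omega * omega_bar = 1], the coefficient of the equation is a multiple of the denominator of
     the profile. *)
  assert (Ea : (- omega - RtoC z ^ 2 = - omega * den z)%C).
  { unfold den. transitivity (- omega - (omega * omega_bar) * RtoC z ^ 2)%C; [|ring].
    rewrite omega_omega_bar. ring. }
  rewrite Ea. unfold logd.
  set (B := den z). set (X := dprofile z).
  assert (Ez : ((omega_bar * RtoC z) * RtoC z = B - 1)%C) by (unfold B, den; ring).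
  assert (NB : B <> 0%C) by apply den_neq_0.
  (* Grouped so that [omega * omega_bar = 1], [omega_bar * z ^ 2 = B - 1] and [omega ^ 2 = Ci] leave
     a rational identity in [B] alone. *)
  transitivity (omega * omega * B * B * X + Ci * X *
    (B * (omega * omega_bar) * (1 + 4 * / B)
     - 8 * (omega * omega_bar) * / B * (omega_bar * RtoC z * RtoC z)
     - B * (omega * omega_bar) * (omega_bar * RtoC z * RtoC z)
         * (1 + 4 * / B) * (1 + 4 * / B)
     + 6 * (omega_bar * RtoC z * RtoC z) * (1 + 4 * / B) - 6))%C.
  { field. exact NB. }
  rewrite omega_omega_bar, Ez, omega_sqr. field. exact NB.
Qed.

(** With [Re_kap_sqr], this supplies the hypotheses of the Gaussian section: [kap] has argument
    [- PI / 8] and its square [- PI / 4]. *)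
Lemma Re_kap_pos : 0 < Re kap.
Proof.
  unfold kap, Cdiv. rewrite <- RtoC_inv by (apply Rgt_not_eq, sqrt_lt_R0; lra).
  unfold rot, Cexp, Re, Im. cbn.
  assert (0 < cos (- (0 * 0 + 1 * (PI / 8)))).
  { pose proof PI_RGT_0. apply cos_gt_0; lra. }
  pose proof inv_sqrt2_pos as P.
  match goal with |- 0 < ?x - ?y * 0 => assert (0 < x); [|lra] end.
  repeat apply Rmult_lt_0_compat; solve [assumption | apply exp_pos].
Qed.

Lemma Re_kap_sqr : Re (kap * kap)%C = / sqrt 2 / 2.
Proof. rewrite kap_sqr. unfold omega_bar. cbn. field. apply Rgt_not_eq, sqrt_lt_R0; lra. Qed.

(** A consequence of [1 + x <= exp x]. The second power of [/ z] compensates the factor [z] of the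
    rational Gaussian term. *)
Lemma exp_neg_sqr_bound (z : R) : 1 <= z ->
  exp (- (/ sqrt 2 / 2) * z ^ 2) <= 2 * sqrt 2 / z / z.
Proof.
  intros Hz. pose proof inv_sqrt2_pos as P.
  assert (S : 0 < sqrt 2) by (apply sqrt_lt_R0; lra).
  set (p := / sqrt 2 / 2) in *.
  assert (Hp : 0 < p) by (unfold p; lra).
  assert (Hpz : 0 < p * z ^ 2) by (apply Rmult_lt_0_compat; [exact Hp | apply pow_lt; lra]).
  replace (2 * sqrt 2 / z / z) with (/ (p * z ^ 2)) by (unfold p; field; lra).
  replace (- p * z ^ 2) with (- (p * z ^ 2)) by ring. rewrite exp_Ropp.
  apply Rinv_le_contravar; [assumption|].
  pose proof (exp_ineq1_le (p * z ^ 2)). lra.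
Qed.

Lemma Cmod_inv_den_le (z : R) : Cmod (/ den z) <= 1.
Proof.
  rewrite Cmod_inv by apply den_neq_0. rewrite <- Rinv_1.
  apply Rinv_le_contravar; [lra|].
  eapply Rle_trans; [|apply re_le_Cmod].
  eapply Rle_trans; [|apply Rle_abs].
  unfold den, omega_bar. cbn. pose proof inv_sqrt2_pos. nra.
Qed.

Lemma Cmod_gau (z : R) : Cmod (gau z) = exp (- (/ sqrt 2 / 2) * z ^ 2).
Proof.
  unfold gau. rewrite Cmod_Cexp. f_equal. unfold omega_bar. cbn.
  field. apply Rgt_not_eq, sqrt_lt_R0; lra.
Qed.

Lemma profile_dist_1 (z : R) : 1 <= z ->
  Cmod (profile z - 1) <=
  (2 / sqrt PI * PI + sqrt (2 / PI)) * (2 * sqrt 2) / z.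
Proof.
  intros Hz.
  assert (S : 0 < sqrt 2) by (apply sqrt_lt_R0; lra).
  pose proof PI_RGT_0 as HPI.
  assert (SP : 0 < sqrt PI) by (apply sqrt_lt_R0; lra).
  (* The constant 1 is split so that half of it is the limit of the error function term;
     [gauss_int_dist] then bounds the difference. *)
  assert (E : (profile z - 1 = RtoC (1 / 2) *
    (RtoC (2 / sqrt PI) * (gauss_int kap z - RtoC (sqrt PI / 2))
     + amp * RtoC z * / den z * gau z))%C).
  { rewrite profile_eq.
    assert (X : (RtoC (2 / sqrt PI) * RtoC (sqrt PI / 2))%C = 1%C).
    { rewrite <- RtoC_mult. f_equal. field. lra. }
    assert (Y : (RtoC (1 / 2) * 2)%C = 1%C).
    { rewrite <- RtoC_mult. f_equal. field. }
    transitivity (RtoC (1 / 2) *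
      (RtoC (2 / sqrt PI) * gauss_int kap z
       - RtoC (2 / sqrt PI) * RtoC (sqrt PI / 2)
       + amp * RtoC z * / den z * gau z) + (RtoC (1 / 2) * 2 - 1))%C; [|rewrite Y; ring].
    rewrite X. ring. }
  rewrite E, Cmod_mult, Cmod_R, Rabs_pos_eq by lra.
  pose proof (gauss_int_dist kap Re_kap_pos
    ltac:(rewrite Re_kap_sqr; pose proof inv_sqrt2_pos; lra) z ltac:(lra)) as G.
  rewrite Re_kap_sqr in G.
  pose proof (exp_neg_sqr_bound z Hz) as X.
  set (e := exp (- (/ sqrt 2 / 2) * z ^ 2)) in *.
  assert (He : 0 < e) by apply exp_pos.
  assert (Sc : 0 <= sqrt (2 / PI)) by apply sqrt_pos.
  assert (T2 : Cmod (amp * RtoC z * / den z * gau z) <= sqrt (2 / PI) * z * e).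
  { rewrite !Cmod_mult, Cmod_gau. fold e. unfold amp.
    rewrite Cmod_mult, Cmod_rot, !Cmod_R, !Rabs_pos_eq by lra.
    pose proof (Cmod_inv_den_le z) as I. pose proof (Cmod_ge_0 (/ den z)).
    apply Rmult_le_compat_r; [lra|].
    assert (0 <= sqrt (2 / PI) * z) by nra. nra. }
  assert (T1 : Cmod (RtoC (2 / sqrt PI) * (gauss_int kap z - RtoC (sqrt PI / 2)))
               <= 2 / sqrt PI * PI * e).
  { assert (0 < 2 / sqrt PI) by (apply Rdiv_lt_0_compat; lra).
    rewrite Cmod_mult, Cmod_R, Rabs_pos_eq by lra. rewrite Rmult_assoc.
    apply Rmult_le_compat_l; lra. }
  pose proof (Cmod_triangle (RtoC (2 / sqrt PI) * (gauss_int kap z - RtoC (sqrt PI / 2)))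
                (amp * RtoC z * / den z * gau z)) as T.
  assert (Hze : z * e <= 2 * sqrt 2 / z).
  { apply Rmult_le_compat_l with (r := z) in X; [|lra].
    replace (z * (2 * sqrt 2 / z / z)) with (2 * sqrt 2 / z) in X by (field; lra).
    exact X. }
  assert (HA : 0 <= 2 / sqrt PI * PI).
  { apply Rmult_le_pos; [|lra]. left. apply Rdiv_lt_0_compat; lra. }
  set (A1 := 2 / sqrt PI * PI) in *.
  replace ((A1 + sqrt (2 / PI)) * (2 * sqrt 2) / z)
    with ((A1 + sqrt (2 / PI)) * (2 * sqrt 2 / z)) by (field; lra).
  set (D := 2 * sqrt 2 / z) in *.
  assert (A1 * e <= A1 * D) by (apply Rmult_le_compat_l; nra).
  assert (sqrt (2 / PI) * (z * e) <= sqrt (2 / PI) * D)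
    by (apply Rmult_le_compat_l; lra).
  assert (0 <= A1 * e) by (apply Rmult_le_pos; lra).
  assert (0 <= sqrt (2 / PI) * (z * e)) by (apply Rmult_le_pos; [lra | nra]).
  lra.
Qed.

(** The error function and the rational term are odd in [z], which transfers the limit at plus
    infinity to minus infinity. *)
Lemma profile_opp (z : R) : profile (- z) = (1 - profile z)%C.
Proof.
  rewrite !profile_eq, gauss_int_opp.
  assert (Eb : den (- z) = den z) by (unfold den; rewrite RtoC_opp; ring).
  assert (Eg : gau (- z) = gau z) by (unfold gau; f_equal; rewrite RtoC_opp; ring).
  rewrite Eb, Eg, RtoC_opp.
  assert (Y : (RtoC (1 / 2) * 2)%C = 1%C).
  { rewrite <- RtoC_mult. f_equal. field. }
  match goal with |- _ = Cminus _ ?r => transitivity (RtoC (1 / 2) * 2 - r)%C end.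
  - ring.
  - now rewrite Y.
Qed.

Lemma profile_solution : shear_layer_solution (- omega) profile.
Proof.
  split; [exact profile_smooth|]. split; [exact profile_equation|].
  eapply filterlim_infinities; [|exact profile_dist_1].
  intros z Hz. rewrite profile_opp.
  replace (1 - profile z - 0)%C with (- (profile z - 1))%C by ring.
  rewrite Cmod_opp. now apply profile_dist_1.
Qed.

Lemma Im_opp_omega : Im (- omega)%C < 0.
Proof. cbn. pose proof inv_sqrt2_pos. lra. Qed.

(** [W'] and [dprofile] have the same logarithmic derivative, so [W' = q * dprofile] and
    [W = q * profile + d]; the limits 0 and 1 force [d = 0] and [q = 1]. *)
Lemma profile_unique (W : R -> C) :
  shear_layer_solution (- omega) W -> forall z, W z = profile z.
Proof.
  intros HW.
  set (W1 := CDerive_n W 1). set (W2 := CDerive_n W 2).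
  pose proof (Csmooth_derives W 0 (proj1 HW)) as D0.
  pose proof (Csmooth_derives W 1 (proj1 HW)) as D1.
  change (derives W W1) in D0. change (derives W1 W2) in D1.
  set (a := fun z => (- omega - RtoC z ^ 2)%C).
  assert (P1 : forall z, CDerive_n profile 1 z = dprofile z)
    by exact (derives_CDerive _ _ derives_profile).
  assert (P2 : forall z, CDerive_n profile 2 z = (logd z * dprofile z)%C).
  { intros z. change (CDerive (CDerive_n profile 1) z = logd z * dprofile z)%C.
    rewrite (CDerive_ext _ dprofile z P1).
    apply (derives_CDerive _ _ derives_dprofile). }
  (* The profile is itself a solution, so comparing [first_order_eq] for [W] and for [profile]
     avoids integrating that equation. *)
  assert (Wr : forall z, (W2 z = logd z * W1 z)%C).
  { intros z.
    pose proof (first_order_eq (- omega) W Im_opp_omega HW z) as E.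
    pose proof (first_order_eq (- omega) profile Im_opp_omega profile_solution z) as E'.
    change (omega * a z * W2 z = - RtoC z * (a z - 4 * omega) * W1 z)%C in E.
    rewrite P1, P2 in E'.
    change (omega * a z * (logd z * dprofile z) = - RtoC z * (a z - 4 * omega) * dprofile z)%C in E'.
    assert (X : (omega * a z * dprofile z * (W2 z - logd z * W1 z) = 0)%C).
    { transitivity (dprofile z * (omega * a z * W2 z) - W1 z * (omega * a z * (logd z * dprofile z)))%C;
        [ring|]. rewrite E, E'. ring. }
    apply Cmult_integral in X. destruct X as [X | X].
    - exfalso. revert X. apply Cmult_neq_0; [apply Cmult_neq_0|].
      + exact omega_neq_0.
      + exact (shear_neq_0 (- omega) Im_opp_omega z).
      + apply dprofile_neq_0.
    - replace (W2 z) with (W2 z - logd z * W1 z + logd z * W1 z)%C by ring. rewrite X. ring. }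
  assert (Q : exists q, forall z, (W1 z = q * dprofile z)%C).
  { exists (W1 0 * / dprofile 0)%C. intros z.
    replace (W1 0 * / dprofile 0)%C with (W1 z * / dprofile z)%C.
    - field. apply dprofile_neq_0.
    - apply (derives_zero_const (fun z => W1 z * / dprofile z)%C).
      refine (derives_ext _ _ _ _
        (derives_mult _ _ _ _ D1 (derives_inv _ _ derives_dprofile dprofile_neq_0)) _ _).
      + reflexivity.
      + intros x. cbn beta. rewrite Wr. field. apply dprofile_neq_0. }
  destruct Q as [q Hq].
  assert (K : exists d, forall z, (W z = q * profile z + d)%C).
  { exists (W 0 - q * profile 0)%C. intros z.
    replace (W 0 - q * profile 0)%C with (W z - q * profile z)%C; [ring|].
    apply (derives_zero_const (fun z => W z - q * profile z)%C).
    refine (derives_ext _ _ _ _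
      (derives_minus _ _ _ _ D0 (derives_cmul q _ _ derives_profile)) _ _).
    - reflexivity.
    - intros x. cbn beta. rewrite Hq. ring. }
  destruct K as [d Hd].
  (* Passes to the limit in [W = q * profile + d] coordinate by coordinate; uniqueness of real
     limits gives the relation. *)
  assert (L : forall (F : Rbar) (l l' : C),
    filterlim W (Rbar_locally' F) (locally (T := C_UniformSpace) l) ->
    filterlim profile (Rbar_locally' F) (locally (T := C_UniformSpace) l') ->
    l = (q * l' + d)%C).
  { intros F l l' H H'.
    apply filterlim_C_pair in H, H'. destruct H as [Hr Hi], H' as [Hr' Hi'].
    pose proof (is_lim_plus' _ _ _ _ _
      (is_lim_minus' _ _ _ _ _ (is_lim_scal_l _ (Re q) _ _ Hr')
         (is_lim_scal_l _ (Im q) _ _ Hi')) (is_lim_const (Re d) F)) as Lr.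
    pose proof (is_lim_plus' _ _ _ _ _
      (is_lim_plus' _ _ _ _ _ (is_lim_scal_l _ (Re q) _ _ Hi')
         (is_lim_scal_l _ (Im q) _ _ Hr')) (is_lim_const (Im d) F)) as Li.
    apply (is_lim_ext _ (fun z => Re (W z))) in Lr;
      [|intros z; rewrite Hd; reflexivity].
    apply (is_lim_ext _ (fun z => Im (W z))) in Li;
      [|intros z; rewrite Hd; reflexivity].
    apply is_lim_unique in Hr, Hi, Lr, Li.
    rewrite Hr in Lr. rewrite Hi in Li. injection Lr as Lr. injection Li as Li.
    apply injective_projections; assumption. }
  destruct HW as [_ [_ [WL1 WL2]]].
  destruct profile_solution as [_ [_ [PL1 PL2]]].
  pose proof (L m_infty _ _ WL1 PL1) as M1.
  pose proof (L p_infty _ _ WL2 PL2) as M2.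
  assert (Hd0 : d = 0%C) by (rewrite M1; ring).
  assert (Hq1 : q = 1%C) by (rewrite M2, Hd0; ring).
  intros z. rewrite Hd, Hd0, Hq1. ring.
Qed.
End Profile.

Lemma opp_omega_exp : (- omega)%C = Cexp (RtoC (5 * PI / 4) * Ci)%C.
Proof.
  unfold Cexp, omega, Re, Im. cbn.
  replace (5 * PI / 4 * 0 - 0 * 1) with 0 by ring.
  (* The half turn contributes the minus sign in front of [omega]. *)
  replace (5 * PI / 4 * 1 + 0 * 0) with (PI / 4 + PI) by field.
  rewrite exp_0, neg_cos, neg_sin. destruct cos_sin_PI4 as [-> ->].
  apply injective_projections; cbn; ring.
Qed.

Lemma opp_omega_div : (- omega)%C = (- ((1 + Ci) / RtoC (sqrt 2)))%C.
Proof.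
  unfold Cdiv. rewrite <- RtoC_inv by (apply Rgt_not_eq, sqrt_lt_R0; lra).
  apply injective_projections; cbn; ring.
Qed.

Theorem corollary1p2 :
  exists (tau : C) (W : R -> C),
    (Im tau < 0 /\ shear_layer_solution tau W) /\
    (forall (tau' : C) (W' : R -> C),
       Im tau' < 0 -> shear_layer_solution tau' W' ->
       tau' = tau /\ forall z : R, W' z = W z) /\
    tau = Cexp (RtoC (5 * PI / 4) * Ci)%C /\
    tau = (- ((1 + Ci) / RtoC (sqrt 2)))%C /\
    forall z : R,
      W z =
        (RtoC (1 / 2) *
         (1 + Cerf (eta z / RtoC (sqrt 2))
          + RtoC (sqrt (2 / PI)) * (eta z / (1 + eta z ^ 2))
            * Cexp (- (eta z ^ 2 / 2))))%C.
Proof.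
  exists (- omega)%C, profile.
  split; [exact (conj Im_opp_omega profile_solution)|].
  split; [|split; [exact opp_omega_exp | split; [exact opp_omega_div | reflexivity]]].
  intros tau' W' Ht HW.
  pose proof (tau_unique tau' W' Ht HW) as E. subst tau'.
  split; [reflexivity | exact (profile_unique W' HW)].
Qed.
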